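(* Let $\Gamma$ be a closed, countable, discrete subgroup of a second countable, locally compact abelian Hausdorff group $G$, and let $\lambda$ be the normalized Haar measure on the compact dual group $\widehat\Gamma$. Let $\alpha:\Gamma\to\Gamma$ be an injective endomorphism with $\Gamma/\alpha(\Gamma)$ finite of order $N>1$ and with dual endomorphism $\alpha^\ast:\widehat\Gamma\to\widehat\Gamma$, $\alpha^\ast(\chi)=\chi\circ\alpha$, ergodic for $\lambda$. Let $\mathcal H$ be a separable Hilbert space, $\pi:\Gamma\to\mathcal U(\mathcal H)$ a unitary representation whose spectral measure is absolutely continuous with respect to $\lambda$, and $\delta:\mathcal H\to\mathcal H$ a unitary operator with $\delta^{-1}\pi(\gamma)\delta=\pi(\alpha(\gamma))$ for all $\gamma\in\Gamma$. Let $V\subset\mathcal H$ be a $\pi$-invariant closed subspace and let $W=\delta(V)$ (which is then also $\pi$-invariant). Let $\widetilde m$ be the multiplicity function of the subrepresentation of $\pi$ on $V$, and let $\mu^\sharp$ and $m^\sharp$ be the spectral measure and multiplicity function of the subrepresentation of $\pi$ on $W$. Then for $\mu^\sharp$-almost all $\chi\in\widehat\Gamma$, $$m^\sharp(\chi)=\sum_{\xi\in\widehat\Gamma,\ \alpha^\ast(\xi)=\chi}\widetilde m(\xi).$$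
   Context: A closed subspace $V\subset\mathcal H$ is $\pi$-invariant if $\pi(\gamma)V\subset V$ for all $\gamma\in\Gamma$; the subrepresentation of $\pi$ on $V$ is $\gamma\mapsto\pi(\gamma)|_V\in\mathcal U(V)$. Spectral data of a unitary representation $\rho$ of $\Gamma$ on a separable Hilbert space $\mathcal K$: a finite Borel measure $\mu$ on $\widehat\Gamma$ (unique up to equivalence), nested Borel sets $\cdots\subset\sigma_2\subset\sigma_1\subset\widehat\Gamma$ (unique up to $\mu$-null sets), and a unitary operator $T:\mathcal K\to\bigoplus_i L^2(\sigma_i,\mu)$ with $[T(\rho(\gamma)f)]_i(\chi)=(\gamma,\chi)[Tf]_i(\chi)$ for all $i$, $\gamma\in\Gamma$, $f\in\mathcal K$, $\mu$-a.e. $\chi$, where $(\gamma,\chi)$ is the value of $\chi$ at $\gamma$, and intertwining the projection valued measure of $\rho$ with multiplication by indicator functions of Borel sets. The multiplicity function of $\rho$ is $m(\chi)=\sum_i I_{\sigma_i}(\chi)\in\{0,1,\dots,+\infty\}$, and $\mu$ is called the spectral measure of $\rho$. When $\mu$ is absolutely continuous with respect to $\lambda$ (which is inherited by subrepresentations), the convention is that $\mu$ is taken to be the restriction of $\lambda$ to $\sigma_1$; thus the $\sigma_i$ and $m$ are determined up to $\lambda$-null sets, and $m=0$ off $\sigma_1$. *)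

(* Defs.v *)
From HB Require Import structures.
From mathcomp Require Import all_boot all_order all_algebra.
From mathcomp Require Import complex sesquilinear.
From mathcomp Require Import all_classical all_reals all_analysis.

Set Implicit Arguments.
Unset Strict Implicit.
Unset Printing Implicit Defensive.

Import Order.TTheory GRing.Theory Num.Theory.
Import numFieldNormedType.Exports.

Local Open Scope classical_set_scope.
Local Open Scope ring_scope.
Local Open Scope complex_scope.

Definition separable (T : topologicalType) : Prop :=
  exists2 A : set T, countable A & dense A.

Record subgroup_of (G : zmodType) (S : zmodClosed G) := SubgroupOf {
  subgroup_val :> G;
  subgroup_valP : subgroup_val \in S }.

Section SubgroupInstances.
Variables (G : zmodType) (S : zmodClosed G).
HB.instance Definition _ := [isSub for @subgroup_val G S].
HB.instance Definition _ := [Choice of subgroup_of S by <:].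
HB.instance Definition _ := [SubChoice_isSubZmodule of subgroup_of S by <:].
End SubgroupInstances.

Definition cosets (Gamma : zmodType) (alpha : {additive Gamma -> Gamma}) :
    set (set Gamma) :=
  range (fun g => [set g + alpha x | x in [set: Gamma]]).


Section DualGroup.
Variables (R : realType) (Gamma : zmodType).

(* The group is discrete, so continuity of characters is automatic and the
   compact-open topology is that of pointwise convergence. *)
Definition characters : set {ptws Gamma -> R[i]^o} :=
  [set f | (forall x, `|f x| = 1 :> R[i]) /\
           (forall x y, f (x + y) = f x * f y :> R[i])].

Definition dual_group : Type := set_type characters.

HB.instance Definition _ := Topological.copy dual_group (set_type characters).

Definition dual_eval (chi : dual_group) : Gamma -> R[i] := set_val chi.
Local Coercion dual_eval : dual_group >-> Funclass.

Lemma dual_norm (chi : dual_group) x : `|chi x| = 1.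
Proof. by have [+ _] := set_mem (valP chi); exact. Qed.

Lemma dual_evalD (chi : dual_group) x y : chi (x + y) = chi x * chi y.
Proof. by have [_ +] := set_mem (valP chi); exact. Qed.

Lemma dual_neq0 (chi : dual_group) x : chi x != 0.
Proof. by rewrite -normr_eq0 dual_norm oner_eq0. Qed.

Definition mk_dual (f : Gamma -> R[i]) (f1 : forall x, `|f x| = 1)
  (fD : forall x y, f (x + y) = f x * f y) : dual_group :=
  exist _ (f : {ptws Gamma -> R[i]^o}) (mem_set (conj f1 fD)).

Lemma dual_ext (chi xi : dual_group) : (forall x, chi x = xi x) -> chi = xi.
Proof. by move=> h; apply: val_inj; apply/funext => x; exact: h. Qed.

Fact dual_one_norm (x : Gamma) : `|1 : R[i]| = 1.
Proof. exact: normr1. Qed.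
Fact dual_oneD (x y : Gamma) : 1 = 1 * 1 :> R[i].
Proof. by rewrite mulr1. Qed.
Definition dual_one : dual_group := mk_dual dual_one_norm dual_oneD.

Fact dual_mul_norm (chi xi : dual_group) x : `|chi x * xi x| = 1.
Proof. by rewrite normrM !dual_norm mulr1. Qed.
Fact dual_mulD (chi xi : dual_group) x y :
  chi (x + y) * xi (x + y) = (chi x * xi x) * (chi y * xi y).
Proof. by rewrite !dual_evalD mulrACA. Qed.
Definition dual_mul (chi xi : dual_group) : dual_group :=
  mk_dual (dual_mul_norm chi xi) (dual_mulD chi xi).

Fact dual_inv_norm (chi : dual_group) x : `|(chi x)^-1| = 1.
Proof. by rewrite normfV dual_norm invr1. Qed.
Fact dual_invD (chi : dual_group) x y :
  (chi (x + y))^-1 = (chi x)^-1 * (chi y)^-1.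
Proof. by rewrite dual_evalD invfM. Qed.
Definition dual_inv (chi : dual_group) : dual_group :=
  mk_dual (dual_inv_norm chi) (dual_invD chi).

Fact dual_mulA : associative dual_mul.
Proof. by move=> a b c; apply: dual_ext => x; exact: mulrA. Qed.
Fact dual_mul1g : left_id dual_one dual_mul.
Proof. by move=> a; apply: dual_ext => x; exact: mul1r. Qed.
Fact dual_mulg1 : right_id dual_one dual_mul.
Proof. by move=> a; apply: dual_ext => x; exact: mulr1. Qed.
Fact dual_mulVg : left_inverse dual_one dual_inv dual_mul.
Proof.
by move=> a; apply: dual_ext => x; exact: mulVf (dual_neq0 a x).
Qed.
Fact dual_mulgV : right_inverse dual_one dual_inv dual_mul.
Proof.
by move=> a; apply: dual_ext => x; exact: mulfV (dual_neq0 a x).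
Qed.

HB.instance Definition _ := isGroup.Build dual_group
  dual_mulA dual_mul1g dual_mulg1 dual_mulVg dual_mulgV.

HB.instance Definition _ := isPointed.Build dual_group dual_one.

HB.instance Definition _ := isMeasurable.Build
  (sigma_display (@open dual_group)) dual_group
  (@sigma_algebra0 _ setT (@open dual_group))
  (@sigma_algebraC _ (@open dual_group))
  (@sigma_algebra_bigcup _ setT (@open dual_group)).

End DualGroup.
Coercion dual_eval : dual_group >-> Funclass.

Section DualEndomorphism.
Variables (R : realType) (Gamma : zmodType) (alpha : {additive Gamma -> Gamma}).

Fact dual_endo_norm (chi : dual_group R Gamma) x : `|chi (alpha x)| = 1.
Proof. exact: dual_norm. Qed.
Fact dual_endoD (chi : dual_group R Gamma) x y :
  chi (alpha (x + y)) = chi (alpha x) * chi (alpha y).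
Proof. by rewrite raddfD dual_evalD. Qed.
Definition dual_endo (chi : dual_group R Gamma) : dual_group R Gamma :=
  mk_dual (dual_endo_norm chi) (dual_endoD chi).

End DualEndomorphism.

Definition normalized_haar (R : realType) (Gamma : zmodType)
    (lambda : probability (dual_group R Gamma) R) : Prop :=
  forall (chi : dual_group R Gamma) (E : set (dual_group R Gamma)),
    measurable E -> lambda [set (chi * xi)%g | xi in E] = lambda E.

(* Preservation of mu by f is not part of the definition; for Haar measure it is
   automatic when f is a surjective endomorphism of the compact dual. *)
Definition ergodic d (T : measurableType d) (R : realType)
    (mu : probability T R) (f : T -> T) : Prop :=
  forall E : set T, measurable E -> f @^-1` E = E -> (mu E = 0 \/ mu E = 1)%E.

HB.mixin Record CompleteNormedModule_isHilbert (R : realType) H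
    & CompleteNormedModule R[i] H := {
  inner : {dot H for (@Num.conj R[i])};
  normr_inner : forall x : H, `|x| ^+ 2 = inner x x }.

#[short(type="hilbertType")]
HB.structure Definition Hilbert (R : realType) :=
  {H of CompleteNormedModule R[i] H & CompleteNormedModule_isHilbert R H}.

Notation "''[' u , v ]" := (inner u v) : ring_scope.

Section ClosedSubspace.
Variables (R : realType) (H : hilbertType R).

Record closed_subspace := ClosedSubspace {
  subspace_set :> set H;
  subspace_closed : closed subspace_set;
  subspace0 : subspace_set 0;
  subspaceP : forall (a : R[i]) x y,
    subspace_set x -> subspace_set y -> subspace_set (a *: x + y) }.

Definition in_subspace (V : closed_subspace) : {pred H} :=
  fun x => x \in subspace_set V.

Fact in_subspace_submod (V : closed_subspace) :
  GRing.submod_closed (in_subspace V).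
Proof.
split; first exact/mem_set/subspace0.
by move=> a x y /set_mem Vx /set_mem Vy; exact/mem_set/subspaceP.
Qed.
HB.instance Definition _ (V : closed_subspace) :=
  GRing.isSubmodClosed.Build R[i] H (in_subspace V) (in_subspace_submod V).

Record subspace_type (V : closed_subspace) := SubspaceType {
  subspace_val :> H;
  subspace_valP : subspace_val \in in_subspace V }.

Section Instances.
Variable V : closed_subspace.
HB.instance Definition _ := [isSub for @subspace_val V].
HB.instance Definition _ := [Choice of subspace_type V by <:].
HB.instance Definition _ := [SubChoice_isSubLmodule of subspace_type V by <:].

Let vnorm (x : subspace_type V) : R[i] := `|subspace_val x|.
Fact vnormD (x y : subspace_type V) : vnorm (x + y) <= vnorm x + vnorm y.
Proof. exact: ler_normD. Qed.
Fact vnormZ (l : R[i]) (x : subspace_type V) :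
  vnorm (l *: x) = `|l| * vnorm x.
Proof. exact: normrZ. Qed.
Fact vnorm_eq0 (x : subspace_type V) : vnorm x = 0 -> x = 0.
Proof. by move=> /normr0_eq0 x0; exact: val_inj. Qed.
HB.instance Definition _ := Lmodule_isNormed.Build R[i] (subspace_type V)
  vnormD vnormZ vnorm_eq0.

Fact subspace_complete (F : set_system (subspace_type V)) :
  ProperFilter F -> cauchy F -> cvg F.
Proof.
move=> FF Fc.
have cF : cauchy (@subspace_val V @ F).
  apply/cauchy_ballP => e e0; move/cauchy_ballP : Fc => /(_ e e0).
  case=> -[A B]/= [FA FB] AB.
  exists (@subspace_val V @` A, @subspace_val V @` B) => /=.
    by split; [apply: filterS FA|apply: filterS FB] => x ?; exists x.
  move=> [? ?] /= [[a Aa <-] [b Bb <-]].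
  by have := AB (a, b) (conj Aa Bb); rewrite /= -!ball_normE.
have [x Fx] := (cvg_ex _).1 (cauchy_cvg _ cF).
have Vx : x \in in_subspace V.
  apply/mem_set; apply: (@closed_cvg _ _ _ FF (@subspace_val V) _ (@subspace_closed V)) Fx.
  by apply: nearW => y; exact: set_mem (subspace_valP y).
apply/cvg_ex; exists (SubspaceType Vx).
apply/cvg_ballP => e e0; move/cvg_ballP : Fx => /(_ e e0).
by rewrite !near_simpl -!ball_normE.
Qed.
HB.instance Definition _ :=
  Uniform_isComplete.Build (subspace_type V) subspace_complete.

Definition subspace_inner (x y : subspace_type V) : R[i] :=
  '[subspace_val x, subspace_val y].

Fact subspace_innerBl v : zmod_morphism (subspace_inner^~ v).
Proof. by move=> x y; exact: linearBl. Qed.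
Fact subspace_innerBr v : zmod_morphism (subspace_inner v).
Proof. by move=> x y; exact: linearBr. Qed.
Fact subspace_innerZl v : scalable_for *%R (subspace_inner^~ v).
Proof. by move=> a x; exact: linearZl_LR. Qed.
Fact subspace_innerZr v :
  scalable_for (Num.conj \; *%R) (subspace_inner v).
Proof. by move=> a x; exact: linearZr. Qed.
HB.instance Definition _ := isBilinear.Build R[i] (subspace_type V)
  (subspace_type V) R[i] *%R (Num.conj \; *%R) subspace_inner
  subspace_innerBl subspace_innerBr subspace_innerZl subspace_innerZr.

Fact subspace_inner_hermitian (x y : subspace_type V) :
  subspace_inner x y = (-1) ^+ false * Num.conj (subspace_inner y x).
Proof. exact: hermitian_subproof. Qed.
HB.instance Definition _ := isHermitianSesquilinear.Build R[i]
  (subspace_type V) false (@Num.conj R[i]) subspace_inner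
  subspace_inner_hermitian.

Fact subspace_inner_gt0 (x : subspace_type V) :
  x != 0 -> 0 < subspace_inner x x.
Proof. by move=> x0; exact: neq0_dnorm_gt0. Qed.
HB.instance Definition _ := isDotProduct.Build R[i] (subspace_type V)
  subspace_inner subspace_inner_gt0.

Fact subspace_normr_inner (x : subspace_type V) :
  `|x| ^+ 2 = (subspace_inner : {dot (subspace_type V) for Num.conj}) x x.
Proof. exact: (normr_inner (subspace_val x)). Qed.
HB.instance Definition _ := CompleteNormedModule_isHilbert.Build R
  (subspace_type V) subspace_normr_inner.

End Instances.
End ClosedSubspace.

Record unitary (R : realType) (H K : hilbertType R) := Unitary {
  unitary_fun :> {linear H -> K};
  unitary_inv : K -> H;
  unitaryK : cancel unitary_fun unitary_inv;
  unitary_invK : cancel unitary_inv unitary_fun;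
  unitary_inner : forall x y : H, '[unitary_fun x, unitary_fun y] = '[x, y] }.

Section UnitaryTheory.
Variables (R : realType) (H K : hilbertType R) (U : unitary H K).

Lemma unitary_norm x : `|U x| = `|x|.
Proof.
apply/eqP; rewrite -(@eqrXn2 _ 2)//.
by rewrite !normr_inner unitary_inner.
Qed.

Lemma unitary_inv_norm y : `|unitary_inv U y| = `|y|.
Proof. by rewrite -unitary_norm unitary_invK. Qed.

Lemma unitary_invB x y :
  unitary_inv U (x - y) = unitary_inv U x - unitary_inv U y.
Proof.
by apply: (can_inj (unitaryK U)); rewrite linearB !unitary_invK.
Qed.

Lemma unitary_inv_continuous : continuous (unitary_inv U).
Proof.
move=> x; apply/cvgrPdist_lt => e e0.
move/cvgrPdist_lt : (@cvg_id _ (nbhs x)) => /(_ e e0).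
by apply: filterS => y; rewrite -unitary_invB unitary_inv_norm.
Qed.

Lemma unitary_image_closed (V : closed_subspace H) : closed (U @` V).
Proof.
suff -> : U @` V = unitary_inv U @^-1` V.
  by apply: closed_comp; [move=> ? _; exact: unitary_inv_continuous
                         |exact: subspace_closed].
apply/seteqP; split=> [_ [x Vx <-]/=|y /= Vy]; first by rewrite unitaryK.
by exists (unitary_inv U y) => //; rewrite unitary_invK.
Qed.

Lemma unitary_image0 (V : closed_subspace H) : (U @` V) 0.
Proof. by exists 0; [exact: subspace0|rewrite linear0]. Qed.

Lemma unitary_imageP (V : closed_subspace H) (a : R[i]) x y :
  (U @` V) x -> (U @` V) y -> (U @` V) (a *: x + y).
Proof.
move=> [u Vu <-] [v Vv <-]; exists (a *: u + v); last by rewrite linearP.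
exact: subspaceP.
Qed.

Definition unitary_image (V : closed_subspace H) : closed_subspace K :=
  ClosedSubspace (@unitary_image_closed V) (unitary_image0 V)
    (@unitary_imageP V).

End UnitaryTheory.

(* No continuity condition: the group is discrete. *)
Record unitary_rep (R : realType) (Gamma : zmodType) (H : hilbertType R) :=
  UnitaryRep {
    rep :> Gamma -> unitary H H;
    repD : forall g h x, rep (g + h) x = rep g (rep h x) }.

Section Subrepresentation.
Variables (R : realType) (Gamma : zmodType) (H : hilbertType R).
Variable pi : unitary_rep Gamma H.

Definition rep_invariant (V : closed_subspace H) : Prop :=
  forall g : Gamma, pi g @` V `<=` V.

Lemma rep0 x : pi 0 x = x.
Proof. by apply: (can_inj (unitaryK (pi 0))); rewrite -repD addr0. Qed.

Variables (V : closed_subspace H) (invV : rep_invariant V).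
Implicit Types (g h : Gamma) (x y : subspace_type V).

Fact subrep_subproof g x : pi g (subspace_val x) \in in_subspace V.
Proof.
apply/mem_set/invV; exists (subspace_val x) => //.
exact: set_mem (subspace_valP x).
Qed.

Definition subrep_fun g x : subspace_type V :=
  SubspaceType (subrep_subproof g x).

Fact subrep_linear g : linear (subrep_fun g).
Proof. by move=> a x y; apply: val_inj; exact: linearP. Qed.
HB.instance Definition _ g := GRing.isLinear.Build R[i] (subspace_type V)
  (subspace_type V) _ (subrep_fun g) (subrep_linear g).

Fact subrepD g h x : subrep_fun (g + h) x = subrep_fun g (subrep_fun h x).
Proof. by apply: val_inj; exact: repD. Qed.
Fact subrepK g : cancel (subrep_fun g) (subrep_fun (- g)).
Proof. by move=> x; rewrite -subrepD addNr; apply: val_inj; exact: rep0. Qed.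
Fact subrepNK g : cancel (subrep_fun (- g)) (subrep_fun g).
Proof. by move=> x; rewrite -subrepD addrN; apply: val_inj; exact: rep0. Qed.
Fact subrep_inner g x y :
  '[subrep_fun g x, subrep_fun g y] = '[x, y] :> R[i].
Proof. exact: (unitary_inner (pi g)). Qed.

Definition subrep_unitary g : unitary (subspace_type V) (subspace_type V) :=
  @Unitary R (subspace_type V) (subspace_type V) (subrep_fun g)
    (subrep_fun (- g)) (subrepK g) (subrepNK g) (subrep_inner g).

Definition subrep : unitary_rep Gamma (subspace_type V) :=
  @UnitaryRep R Gamma (subspace_type V) subrep_unitary subrepD.

End Subrepresentation.

Lemma invariant_unitary_image (R : realType) (Gamma : zmodType)
    (H : hilbertType R) (alpha : Gamma -> Gamma) (pi : unitary_rep Gamma H)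
    (delta : unitary H H) (V : closed_subspace H) :
  (forall g x, unitary_inv delta (pi g (delta x)) = pi (alpha g) x) ->
  rep_invariant pi V -> rep_invariant pi (unitary_image delta V).
Proof.
move=> dp iV g _ [_ [x Vx <-] <-]; exists (pi (alpha g) x).
  by apply: (iV (alpha g)); exists x.
by rewrite -dp unitary_invK.
Qed.

Section SpectralData.
Variables (R : realType) (Gamma : zmodType).
Local Notation D := (dual_group R Gamma).
Local Notation finmeas := {finite_measure set D -> \bar R}.

Definition cmeasurable (f : D -> R[i]) : Prop :=
  measurable_fun [set: D] (fun chi => complex.Re (f chi)) /\
  measurable_fun [set: D] (fun chi => complex.Im (f chi)).

Definition cintegral (mu : finmeas) (f : D -> R[i]) : R[i] :=
  (Rintegral mu [set: D] (fun chi => complex.Re (f chi))) +i*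
  (Rintegral mu [set: D] (fun chi => complex.Im (f chi))).

(* Representatives of the elements of the direct sum of the L^2(sigma_i, mu):
   a function on sigma_i is extended by zero, and the families are meant up to
   mu-a.e. equality. *)
Definition L2_sum (mu : finmeas) (sigma : nat -> set D)
    (F : nat -> D -> R[i]) : Prop :=
  [/\ forall i, cmeasurable (F i),
      forall i chi, ~ sigma i chi -> F i chi = 0 &
      (\sum_(i <oo) \int[mu]_chi ((Normc.normc (F i chi)) ^+ 2)%:E < +oo)%E].

(* A unitary operator from K onto the direct sum, given by representatives. *)
Definition L2_unitary (K : hilbertType R) (mu : finmeas)
    (sigma : nat -> set D) (T : K -> nat -> D -> R[i]) : Prop :=
  [/\ forall f, L2_sum mu sigma (T f),
      forall (a : R[i]) f g i,
        {ae mu, forall chi, T (a *: f + g) i chi = a * T f i chi + T g i chi},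
      forall f g,
        (fun n => \sum_(i < n)
           cintegral mu (fun chi => T f i chi * Num.conj (T g i chi)) : R[i]^o)
          @ \oo --> ('[f, g] : R[i]^o) &
      forall F, L2_sum mu sigma F ->
        exists f, forall i, {ae mu, forall chi, T f i chi = F i chi}].

Definition orthogonal_projection (K : hilbertType R) (P : K -> K) : Prop :=
  [/\ linear P, forall f, P (P f) = P f & forall f g, '[P f, g] = '[f, P g]].

Definition projection_valued_measure (K : hilbertType R)
    (p : set D -> K -> K) : Prop :=
  [/\ forall E, measurable E -> orthogonal_projection (p E),
      forall f, p [set: D] f = f,
      forall E F f, measurable E -> measurable F ->
        p (E `&` F) f = p E (p F f) &
      forall (E : nat -> set D) f, (forall i, measurable (E i)) ->
        trivIset [set: nat] E ->
        (fun n => \sum_(i < n) p (E i) f) @ \oo --> p (\bigcup_i E i) f].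

(* rho g = \int (g, chi) dp(chi), in the weak sense, the quadratic forms
   determining the operators by polarization. *)
Definition pvm_of_rep (K : hilbertType R) (rho : unitary_rep Gamma K)
    (p : set D -> K -> K) : Prop :=
  projection_valued_measure p /\
  forall f : K, exists nu : finmeas,
    (forall E, measurable E -> '[p E f, f] = (fine (nu E))%:C) /\
    (forall g : Gamma, '[rho g f, f] = cintegral nu (fun chi => chi g)).

(* sigma i is the set written sigma_(i+1) in the mathematics. The measure mu is
   carried by sigma 0; without this mu would not be unique up to equivalence. *)
Definition spectral_data (K : hilbertType R) (rho : unitary_rep Gamma K)
    (mu : finmeas) (sigma : nat -> set D) (T : K -> nat -> D -> R[i]) : Prop :=
  [/\ [/\ forall i, measurable (sigma i),
          forall i, sigma i.+1 `<=` sigma i &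
          mu (~` sigma 0%N) = 0%E],
      L2_unitary mu sigma T,
      forall (g : Gamma) f i,
        {ae mu, forall chi, T (rho g f) i chi = chi g * T f i chi} &
      exists p, pvm_of_rep rho p /\
        forall E f i, measurable E ->
          {ae mu, forall chi, T (p E f) i chi = \1_E chi * T f i chi}].

Definition multiplicity (sigma : nat -> set D) (chi : D) : \bar R :=
  (\sum_(i <oo) (\1_(sigma i) chi)%:E)%E.

Definition spectral_measure_ac (K : hilbertType R) (rho : unitary_rep Gamma K)
    (lambda : probability D R) : Prop :=
  exists mu sigma T, spectral_data rho mu sigma T /\ mu `<< lambda.

(* mu and m are the spectral measure and the multiplicity function of rho, when
   the former is absolutely continuous with respect to lambda, with the
   normalization that mu is the restriction of lambda to sigma_1. *)
Definition spectral_measure_mult (K : hilbertType R)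
    (rho : unitary_rep Gamma K) (lambda : probability D R)
    (mu : finmeas) (m : D -> \bar R) : Prop :=
  exists sigma T,
    [/\ spectral_data rho mu sigma T,
        forall E, measurable E -> mu E = lambda (E `&` sigma 0%N) &
        forall chi, m chi = multiplicity sigma chi].

End SpectralData.

(* Main.v *)
Require Import Defs.
From HB Require Import structures.
From mathcomp Require Import all_boot all_order all_algebra.
From mathcomp Require Import complex sesquilinear.
From mathcomp Require Import all_classical all_reals all_analysis.
From mathcomp Require Import measurable_realfun ring lra.
Import Order.TTheory GRing.Theory Num.Theory.
Import numFieldNormedType.Exports.
Local Open Scope classical_set_scope.
Local Open Scope ring_scope.

(* Both representations are read through "brackets": the density on the dual
   group of the measure with Fourier coefficients <pi(g) f, f'>.  If e_i
   generates the i-th summand of the model of V, r_l runs over representatives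
   of Gamma / alpha(Gamma), e'_j generates the j-th summand of the model of W,
   and g_j = delta^-1 e'_j, then the j-th coordinate F_ilj of delta pi(r_l) e_i
   is the bracket of delta pi(r_l) e_i with e'_j.  Since
   <pi(g) delta f, delta f'> = <pi(alpha g) f, f'>, F_ilj is the average over
   the fibres of alpha^* of xi(r_l) times the conjugate of the i-th coordinate
   of g_j, and the orthogonality relations of the finite group
   Gamma / alpha(Gamma) evaluate the sum of |F_ilj|^2 over l.  Summing over i
   and j in the two possible orders gives the sum of the multiplicities of V
   over a fibre on one side, and the multiplicity of W on the other. *)

(** The spectral models of V and W are given independently of each other and share nothing but inner
    products. Hence everything is compared through Fourier coefficients. The coefficients of W at b
    are those of V at alpha(b), so they see only alpha(Gamma), that is, only averages over the
    fibres of alpha^*. One average of a bracket loses information about its values on the fibre;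
    twisting it by the characters' values at the N representatives r_l recovers the sum of squares,
    by Plancherel on the fibre. All identities are first proved at a point xi, with chi =
    alpha^*(xi), where the fibre is the finite family of translates k xi by the kernel. Returning to
    chi needs its own argument, since the image of a null set under alpha^* is not visibly
    measurable. Uniqueness of Fourier coefficients, measurability of maps into the dual, invariance
    of Haar measure under alpha^* and the descent to chi all rest on one induction,
    [indicator_induction]: what holds for real and imaginary parts of characters and is stable under
    linear combinations and limits of [0,1]-valued sequences holds for indicators of Borel sets. *)

Set Implicit Arguments.
Unset Strict Implicit.
Unset Printing Implicit Defensive.

(** * Characters of discrete groups and the dual endomorphism *)

Section CharacterExtension.
Variables (R : realType) (Gamma : zmodType).
Local Open Scope complex_scope.
Implicit Types (S : set Gamma) (c : Gamma -> R[i]) (x y : Gamma).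

(** A character of the subgroup [S], carried by a total function so that domains can grow without
    change of type; the values of [c] off [S] mean nothing. *)
Definition partial_char S c : Prop :=
  [/\ S 0, forall x y, S x -> S y -> S (x - y),
      forall x, S x -> `|c x| = 1 &
      forall x y, S x -> S y -> c (x + y) = c x * c y].

Section PartialChar.
Variables (S : set Gamma) (c : Gamma -> R[i]).
Hypothesis Sc : partial_char S c.

Lemma partial_charN x : S x -> S (- x).
Proof. by case: Sc => S0 SB _ _ Sx; rewrite -sub0r; exact: SB. Qed.

Lemma partial_charD x y : S x -> S y -> S (x + y).
Proof.
by case: Sc => S0 SB _ _ Sx /partial_charN Sy; rewrite -[y]opprK; exact: SB.
Qed.

Lemma partial_charMn x n : S x -> S (x *+ n).
Proof.
by move=> Sx; elim: n => [|n IH]; rewrite ?mulr0n ?mulrS; [case: Sc|exact: partial_charD].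
Qed.

Lemma partial_char_neq0 x : S x -> c x != 0.
Proof. by case: Sc => _ _ c1 _ Sx; rewrite -normr_eq0 c1// oner_eq0. Qed.

Lemma partial_char0 : c 0 = 1.
Proof.
case: (Sc) => S0 _ _ cD; apply: (mulfI (partial_char_neq0 S0)).
by rewrite -cD// addr0 mulr1.
Qed.

Lemma partial_charX x n : S x -> c (x *+ n) = c x ^+ n.
Proof.
move=> Sx; elim: n => [|n IH]; first by rewrite mulr0n expr0 partial_char0.
by case: (Sc) => _ _ _ cD; rewrite mulrS exprS -IH cD//; exact: partial_charMn.
Qed.

End PartialChar.

(** If w is not 1, any root will do. If w = 1 and m > 1, take a root of 1 + X + ... + X^(m-1): it is
    an m-th root of unity, and it is not 1 because that polynomial takes the value m at 1. *)
Lemma nontrivial_root (w : R[i]) m : (0 < m)%N ->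
  exists z : R[i], z ^+ m = w /\ ((1 < m)%N -> z != 1).
Proof.
move=> m0.
have [->|w1] := eqVneq w 1; last first.
  have [z zP] := solve_monicpoly (fun i => if i == 0%N then w else 0) m0.
  exists z; split.
    rewrite zP (bigD1 (Ordinal m0))//= expr0 mulr1 big1 ?addr0// => i i0.
    by rewrite ifN ?mul0r.
  by move=> _; apply: contra_neq w1 => z1; rewrite -(expr1n _ m) -z1 zP;
     rewrite (bigD1 (Ordinal m0))//= expr0 mulr1 big1 ?addr0// => i i0;
     rewrite ifN ?mul0r.
case: m m0 => [//|[|m] _]; first by exists 1; rewrite expr1.
have [z zP] := solve_monicpoly (fun=> -1 : R[i]) (ltn0Sn m).
have z0 : \sum_(i < m.+2) z ^+ i = 0.
  rewrite big_ord_recr/= zP -big_split big1//= => i _.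
  by rewrite mulN1r addrN.
exists z; split.
  by apply/eqP; rewrite -subr_eq0 subrX1 z0 mulr0.
move=> _; apply/eqP => z1; move: z0; rewrite z1.
under eq_bigr do rewrite expr1n.
by rewrite sumr_const card_ord => /eqP; rewrite pnatr_eq0.
Qed.

(** With k the least positive integer such that k x lies in S, any z with z^k = c(k x) defines c'(s
    + n x) = c(s) z^n. If x is outside S then k > 1, so z can be chosen different from 1; this last
    clause is what separates points later. *)
Lemma partial_char_step S c x m : partial_char S c -> (0 < m)%N ->
  S (x *+ m) ->
  exists S' c', [/\ partial_char S' c', S `<=` S', S' x,
    forall y, S y -> c' y = c y & (~ S x -> c' x != 1)].
Proof.
move=> Sc m0 Sxm; have [S0 SB c1 cD] := Sc.
have Pex : exists n, (0 < n)%N && `[< S (x *+ n) >].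
  by exists m; rewrite m0; exact/asboolP.
case: (ex_minnP Pex) => k /andP[k0 /asboolP Sk] kmin.
have kdvd n : S (x *+ n) -> (k %| n)%N.
  move=> Sn; rewrite /dvdn; apply/negP => /negP; rewrite -lt0n => r0.
  have : (k <= n %% k)%N.
    apply: kmin; rewrite r0; apply/asboolP.
    have -> : x *+ (n %% k) = x *+ n - x *+ k *+ (n %/ k).
      by rewrite {2}(divn_eq n k) mulrnDr -mulrnA mulnC addrAC subrr add0r.
    by apply: SB => //; exact: (partial_charMn Sc).
  by rewrite leqNgt ltn_pmod.
have [z [zk z1]] := nontrivial_root (c (x *+ k)) k0.
have nz : `|z| = 1.
  by apply/eqP; rewrite -(@pexpr_eq1 _ _ k)//; rewrite -normrX zk c1.
(* [xget] picks some decomposition y = s + n x, and [wd] shows that the choice is immaterial; the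
   default is reached only off the enlarged subgroup. *)
pose rp y := [set p : Gamma * nat | S p.1 /\ y = p.1 + x *+ p.2].
pose c' y := let p := xget (0, 0%N) (rp y) in c p.1 * z ^+ p.2.
have wd s n s' n' : S s -> S s' -> s + x *+ n = s' + x *+ n' ->
    c s * z ^+ n = c s' * z ^+ n'.
  wlog nn' : s n s' n' / (n <= n')%N.
    move=> H Ss Ss' e; have [/H|/ltnW/H] := leqP n n'; first exact.
    by move=> /(_ _ _ Ss' Ss (esym e)) ->.
  move=> Ss Ss' e.
  have es : s = s' + x *+ (n' - n).
    by rewrite mulrnBr// addrA -e addrK.
  have /kdvd/dvdnP[q qE] : S (x *+ (n' - n)).
    have -> : x *+ (n' - n) = s - s' by rewrite es addrAC subrr add0r.
    exact: SB.
  rewrite -(subnK nn') exprD mulrA; congr (_ * _).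
  rewrite es qE mulnC mulrnA cD//; last exact: (partial_charMn Sc).
  by rewrite (partial_charX Sc)// -zk exprM.
have c'E s n : S s -> c' (s + x *+ n) = c s * z ^+ n.
  move=> Ss; rewrite /c'; case: xgetP => [p _ [Sp e]|/(_ (s, n))[]//].
  by apply: wd.
exists [set y | exists s n, S s /\ y = s + x *+ n], c'.
have c'S y : S y -> c' y = c y.
  by move=> Sy; rewrite -[y in LHS](addr0 y) -(mulr0n x) c'E// expr0 mulr1.
have c'x : c' x = z.
  by rewrite -[x in LHS](add0r x) -[x in 0 + x]mulr1n c'E// (partial_char0 Sc) mul1r expr1.
split => //=.
- split.
  + by exists 0, 0%N; rewrite mulr0n addr0.
  + move=> _ _ [s [n [Ss ->]]] [t [q [St ->]]].
    (* Multiples of x are indexed by naturals, so -q x is rewritten as -(k q) x + (k-1) q x, where k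
       q x lies in S. *)
    exists (s - t - x *+ k *+ q), (n + k.-1 * q)%N; split.
      by apply: (SB) => //; [exact: SB|exact: (partial_charMn Sc)].
    have -> : x *+ k *+ q = x *+ (k.-1 * q) + x *+ q.
      by rewrite -mulrnA -mulrnDr -mulSnr prednK.
    by rewrite mulrnDr -[RHS]addrA [- _ + _]addrC addrKA opprD addrACA.
  + by move=> _ [s [n [Ss ->]]]; rewrite c'E// normrM normrX nz expr1n c1// mulr1.
  + move=> _ _ [s [n [Ss ->]]] [t [q [St ->]]].
    rewrite addrACA -mulrnDr !c'E//; last exact: (partial_charD Sc).
    by rewrite cD// exprD mulrACA.
- by move=> y Sy; exists y, 0%N; rewrite mulr0n addr0.
- by exists 0, 1%N; rewrite mulr1n add0r.
- move=> Sx; rewrite c'x; apply: z1; rewrite ltn_neqAle k0 andbT.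
  by apply/eqP => k1; apply: Sx; move: Sk; rewrite -k1 mulr1n.
Qed.

(** A finite list is enough: it will be a list of coset representatives of alpha(Gamma). *)
Lemma partial_char_extend S c (s : seq Gamma) :
  (forall x, exists2 m, (0 < m)%N & S (x *+ m)) -> partial_char S c ->
  exists S' c', [/\ partial_char S' c', S `<=` S', {in s, forall x, S' x} &
    forall y, S y -> c' y = c y].
Proof.
move=> tor Sc; elim: s => [|x s [S1 [c1 [Sc1 SS1 sS1 cc1]]]].
  by exists S, c; split.
have [m m0 /SS1 Sm] := tor x.
have [S' [c' [Sc' S1S' S'x cc' _]]] := partial_char_step Sc1 m0 Sm.
exists S', c'; split => //; first exact: subset_trans S1S'.
  by move=> y; rewrite inE => /orP[/eqP->//|/sS1/S1S'].
by move=> y Sy; rewrite cc' ?cc1//; exact: SS1.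
Qed.

End CharacterExtension.

(** * Surjectivity and finite kernel of the dual endomorphism *)

Section DualEndo.
Variables (R : realType) (Gamma : zmodType).
Variables (alpha : {additive Gamma -> Gamma}) (N : nat).
Hypothesis alpha_index : (cosets alpha #= `I_N)%card.
Local Notation D := (dual_group R Gamma).

Lemma coset_representatives : exists r : 'I_N -> Gamma,
  (forall x, exists l y, x = r l + alpha y) /\
  (forall l l' y, r l = r l' + alpha y -> l = l').
Proof.
move: alpha_index; rewrite card_eq_sym => /card_set_bijP[f [f1 finj fsurj]].
have fI (l : 'I_N) : exists g, f l = [set g + alpha x | x in [set: Gamma]].
  by have [g _ <-] := f1 l (ltn_ord l); exists g.
have [r rP] := choice fI; exists r; split.
  move=> x.
  have [l lN /esym fl] := fsurj [set x + alpha y | y in [set: Gamma]]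
    (ex_intro2 _ _ x I erefl).
  have := rP (Ordinal lN); rewrite -fl => /seteqP[+ _] => /(_ x)[].
    by exists 0 => //; rewrite raddf0 addr0.
  by move=> y _ <-; exists (Ordinal lN), y.
move=> l l' y e; apply/val_inj/finj; rewrite ?inE//=.
rewrite !rP e; apply/seteqP; split => _ [x _ <-].
  by exists (y + x) => //; rewrite raddfD addrA.
by exists (x - y) => //; rewrite raddfB addrACA subrr addr0.
Qed.

(** Pigeonhole: among the N+1 multiples 0 x, ..., N x two lie in the same coset. *)
Lemma torsion_mod_image x : exists2 m, (0 < m)%N & exists y, x *+ m = alpha y.
Proof.
have [r [r1 r2]] := coset_representatives.
have /choice[f fP] : forall n : 'I_N.+1, exists l, exists y, x *+ n = r l + alpha y.
  by move=> n; apply: r1.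
have : ~~ injectiveb f.
  apply/negP => /injectiveP /leq_card; rewrite !card_ord ltnn//.
move=> /injectivePn[a [b ab fab]].
wlog lt_ab : a b ab fab / (a < b)%N.
  move=> H; case: (ltngtP a b) => [/H|/H|/ord_inj/eqP]; [exact| |by rewrite (negbTE ab)].
  by apply; rewrite 1?eq_sym.
have [ya ea] := fP a; have [yb eb] := fP b.
exists (b - a)%N; first by rewrite subn_gt0.
exists (yb - ya); rewrite mulrnBr ?(ltnW lt_ab)// ea eb fab raddfB.
by rewrite opprD addrACA subrr add0r.
Qed.

Lemma extend_from_image S (c : Gamma -> R[i]) : partial_char S c ->
  range alpha `<=` S -> exists chi : D, forall x, S x -> chi x = c x.
Proof.
move=> Sc aS; have [r [r1 _]] := coset_representatives.
have tor x : exists2 m, (0 < m)%N & S (x *+ m).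
  by have [m m0 [y e]] := torsion_mod_image x; exists m => //; apply: aS; exists y.
have [S' [c' [Sc' SS' rS' cc']]] := partial_char_extend (codom r) tor Sc.
have S'T x : S' x.
  have [l [y ->]] := r1 x; apply: (partial_charD Sc'); first exact/rS'/codom_f.
  by apply/SS'/aS; exists y.
have [_ _ c1 cD] := Sc'.
exists (mk_dual (fun x => c1 x (S'T x)) (fun x y => cD x y (S'T x) (S'T y))).
exact: cc'.
Qed.

(** Injectivity makes chi composed with the inverse of alpha a character of alpha(Gamma), and any
    extension of it to Gamma is a preimage of chi. *)
Lemma dual_endo_surj : injective alpha ->
  forall chi : D, exists xi, dual_endo alpha xi = chi.
Proof.
move=> ainj chi.
have /choice[f fP] : forall x, exists y, range alpha x -> x = alpha y.
  move=> x; have [[y _ <-]|nx] := pselect (range alpha x); first by exists y.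
  by exists 0.
have fK : cancel alpha f.
  by move=> x; apply: ainj; rewrite -fP//; exists x.
have [|//|xi xiP] := @extend_from_image (range alpha) (chi \o f).
  split => /=.
  - by exists 0 => //; rewrite raddf0.
  - by move=> _ _ [x _ <-] [y _ <-]; exists (x - y) => //; rewrite raddfB.
  - by move=> x _; exact: dual_norm.
  - by move=> _ _ [x _ <-] [y _ <-]; rewrite -raddfD !fK dual_evalD.
exists xi; apply: dual_ext => x.
by rewrite -[LHS]/(xi (alpha x)) xiP /= ?fK//; exists x.
Qed.

(** Extend the trivial character of alpha(Gamma) first to x, with a value other than 1, and then to
    all of Gamma. *)
Lemma annihilator_separates x : ~ range alpha x ->
  exists2 k : D, dual_endo alpha k = 1%g & k x != 1.
Proof.
move=> nx; have [m m0 [y e]] := torsion_mod_image x.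
have pc1 : partial_char (range alpha) (fun=> 1 : R[i]).
  split => /=.
  - by exists 0 => //; rewrite raddf0.
  - by move=> _ _ [u _ <-] [v _ <-]; exists (u - v) => //; rewrite raddfB.
  - by move=> *; rewrite normr1.
  - by move=> *; rewrite mulr1.
have xm : range alpha (x *+ m) by exists y.
have [S' [c' [Sc' SS' S'x cc' /(_ nx) c'x]]] := partial_char_step pc1 m0 xm.
have [k kP] := extend_from_image Sc' SS'.
exists k; last by rewrite kP.
apply: dual_ext => u; have au : range alpha (alpha u) by exists u.
by rewrite -[LHS]/(k (alpha u)) (kP _ (SS' _ au)) (cc' _ au).
Qed.

Lemma kernel_coset (k : D) x y : dual_endo alpha k = 1%g -> k (x + alpha y) = k x.
Proof.
move=> k1; rewrite dual_evalD -[k (alpha y)]/(dual_endo alpha k y) k1.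
exact: mulr1.
Qed.

(** A kernel element is determined by its values at the representatives, and these are roots of
    unity of a common order [M], the product of the exponents that carry each representative into
    alpha(Gamma). *)
Lemma kernel_finite : finite_set [set k : D | dual_endo alpha k = 1%g].
Proof.
have [r [r1 _]] := coset_representatives.
have /choice[m mP] : forall l, exists m, (0 < m)%N /\ exists y, r l *+ m = alpha y.
  by move=> l; have [m] := torsion_mod_image (r l); exists m.
pose M := (\prod_l m l)%N.
have M0 : (0 < M)%N by apply: prodn_gt0 => l; case: (mP l).
have [rs rsP] := closed_field_poly_normal ('X^M - 1 : {poly R[i]}).
have rsM z : z ^+ M = 1 -> z \in rs.
  move=> zM; have : root ('X^M - 1 : {poly R[i]}) z.
    by rewrite rootE !hornerE zM subrr.
  rewrite rsP rootZ ?root_prod_XsubC// lead_coef_eq0.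
  by rewrite -size_poly_eq0 -[X in _ - X]polyC1 size_XnsubC.
pose h (k : D) : {ffun 'I_N -> R[i]} := [ffun l => k (r l)].
pose A := range (fun g : {ffun 'I_N -> seq_sub rs} => [ffun l => ssval (g l)]).
have fA : finite_set A by apply: finite_image; exact: finite_finset.
have hinj : {in [set k : D | dual_endo alpha k = 1%g] &, injective h}.
  move=> k k'; rewrite !inE => k1 k'1 e; apply: dual_ext => x.
  have [l [y ->]] := r1 x; rewrite !kernel_coset//.
  by move/ffunP: e => /(_ l); rewrite !ffunE.
have [g gE] := Pinj hinj; rewrite -(eq_finite_set (card_image g)) -gE.
apply: sub_finite_set fA.
move=> _ [k /= k1 <-].
  have kM l : k (r l) \in rs.
    apply: rsM; have [_ [y ey]] := mP l.
    have kX n : k (r l *+ n) = k (r l) ^+ n.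
      elim: n => [|n IH]; last by rewrite mulrS exprS -IH dual_evalD.
      have : k 0 * k 0 = k 0 * 1 by rewrite -dual_evalD addr0 mulr1.
      by move/(mulfI (dual_neq0 _ _)).
    have -> : M = (m l * \prod_(l' | l' != l) m l')%N by rewrite /M (bigD1 l).
    rewrite exprM -kX ey -[k (alpha y)]/(dual_endo alpha k y) k1.
    exact: expr1n.
by exists [ffun l => SeqSub (kM l)] => //; apply/ffunP => l; rewrite !ffunE.
Qed.

End DualEndo.

(** * Real and imaginary parts of characters, and the topology they induce *)

Section RealImaginaryParts.
Variables (R : realType) (Gamma : zmodType).
Local Open Scope complex_scope.
Local Notation D := (dual_group R Gamma).
Implicit Types (g : Gamma) (chi : D).

Definition re_char g chi : R := complex.Re (chi g).
Definition im_char g chi : R := complex.Im (chi g).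

Lemma dual_eval0 chi : chi 0 = 1.
Proof.
apply: (mulfI (dual_neq0 chi 0)).
by rewrite -dual_evalD addr0 mulr1.
Qed.

Lemma re_im_char1 g chi : re_char g chi ^+ 2 + im_char g chi ^+ 2 = 1.
Proof.
have /(congr1 (@complex.Re R)) := add_Re2_Im2 (chi g).
by rewrite dual_norm expr1n.
Qed.

Lemma dual_evalN g chi : chi (- g) = Num.conj (chi g).
Proof.
apply: (mulfI (dual_neq0 chi g)); rewrite -dual_evalD subrr dual_eval0.
by rewrite -normCK dual_norm expr1n.
Qed.

Lemma re_charN g chi : re_char (- g) chi = re_char g chi.
Proof. by rewrite /re_char dual_evalN; case: (chi g). Qed.

Lemma im_charN g chi : im_char (- g) chi = - im_char g chi.
Proof. by rewrite /im_char dual_evalN; case: (chi g). Qed.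

Lemma re_charD g h chi :
  re_char (g + h) chi = re_char g chi * re_char h chi - im_char g chi * im_char h chi.
Proof. by rewrite /re_char /im_char dual_evalD; case: (chi g) => a b; case: (chi h). Qed.

Lemma im_charD g h chi :
  im_char (g + h) chi = re_char g chi * im_char h chi + im_char g chi * re_char h chi.
Proof. by rewrite /re_char /im_char dual_evalD; case: (chi g) => a b; case: (chi h). Qed.

Lemma normr_re_char g chi : `|re_char g chi| <= 1.
Proof.
rewrite -(@ler_pXn2r _ 2)// ?nnegrE// expr1n real_normK ?num_real//.
by rewrite -(re_im_char1 g chi) lerDl sqr_ge0.
Qed.

Lemma normr_im_char g chi : `|im_char g chi| <= 1.
Proof.
rewrite -(@ler_pXn2r _ 2)// ?nnegrE// expr1n real_normK ?num_real//.
by rewrite -(re_im_char1 g chi) lerDr sqr_ge0.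
Qed.

Lemma dual_eval_continuous g : continuous (fun chi : D => chi g : R[i]^o).
Proof.
move=> chi.
have h := @proj_continuous Gamma (fun=> R[i]^o) g (set_val chi).
apply: cvg_trans h.
have h0 : {for chi, continuous (set_val : D -> {ptws Gamma -> R[i]^o})}.
  exact: (@initial_continuous _ {ptws Gamma -> R[i]^o} (@set_val _ (@characters R Gamma))).
exact: cvg_app h0.
Qed.

Lemma normC_ltP (z : R[i]) (e : R) : `|z| < e%:C -> `|complex.Re z| < e /\ `|complex.Im z| < e.
Proof.
case: z => a b; rewrite normc_def/= ltcR => h.
have h2 c d : Num.sqrt (c ^+ 2 + d ^+ 2) < e -> `|c| < e.
  by apply: le_lt_trans; rewrite -sqrtr_sqr ler_sqrt ?lerDl ?sqr_ge0// addr_ge0 ?sqr_ge0.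
by split; [exact: (h2 _ b)|apply: (h2 _ a); rewrite addrC].
Qed.

Lemma re_char_continuous g : continuous (re_char g).
Proof.
move=> chi; apply: (proj2 (@cvgrPdist_lt R R^o D (nbhs chi) (nbhs_filter chi) _ _)) => e e0.
have /(@cvgrPdist_lt _ _ D (nbhs chi) (nbhs_filter chi) _ _)/(_ e%:C) := @dual_eval_continuous g chi.
rewrite ltcR => /(_ e0); apply: filterS => xi /normC_ltP[+ _].
by rewrite raddfB.
Qed.

Lemma im_char_continuous g : continuous (im_char g).
Proof.
move=> chi; apply: (proj2 (@cvgrPdist_lt R R^o D (nbhs chi) (nbhs_filter chi) _ _)) => e e0.
have /(@cvgrPdist_lt _ _ D (nbhs chi) (nbhs_filter chi) _ _)/(_ e%:C) := @dual_eval_continuous g chi.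
rewrite ltcR => /(_ e0); apply: filterS => xi /normC_ltP[_].
by rewrite raddfB.
Qed.

Lemma dual_cvgP (F : set_system D) chi : Filter F ->
  (forall g, re_char g @ F --> re_char g chi) ->
  (forall g, im_char g @ F --> im_char g chi) -> F --> chi.
Proof.
move=> FF hre him A.
move=> [B [[C oC CB] Bchi] BA]; rewrite nbhs_filterE; apply: filterS BA _.
rewrite -CB.
suff : {ptws, (set_val @ F) --> (set_val chi : {ptws Gamma -> R[i]^o})}.
  apply; apply: open_nbhs_nbhs; split => //.
  by have : (set_val @^-1` C) chi by rewrite CB.
apply: (proj2 (cvg_sup _ _ _)) => g B' [_ [[U oU <-] Ug UB]].
rewrite nbhs_filterE; apply: filterS UB _.
suff : (fun xi : D => xi g : R[i]^o) @ F --> (chi g : R[i]^o).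
  by apply; apply: open_nbhs_nbhs; split.
apply/cvgrPdist_lt => -[e e'] e0.
(* In the order of R[i] a positive number has zero imaginary part, so the radius is real. *)
have [{}e0 e'0] : 0 < e /\ e' = 0 by move: e0; rewrite ltcE/= => /andP[/eqP].
rewrite e'0.
have e2 : 0 < e / 2 by rewrite divr_gt0.
have /cvgrPdist_lt/(_ _ e2) H1 := hre g.
have /cvgrPdist_lt/(_ _ e2) H2 := him g.
near=> xi.
have h1 : `|re_char g chi - re_char g xi| < e / 2 by near: xi.
have h2 : `|im_char g chi - im_char g xi| < e / 2 by near: xi.
change (`|chi g - xi g| < e%:C).
move: h1 h2; rewrite /re_char /im_char; case: (chi g) => a b; case: (xi g) => c d /= h1 h2.
rewrite [X in `|X|]complexE; apply: le_lt_trans (ler_normD _ _) _.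
rewrite normrM normCi mul1r /= !normc_def/= !expr0n/= !addr0 !sqrtr_sqr.
by rewrite -rmorphD/= ltcR (splitr e) ltrD.
Unshelve. all: by end_near. Qed.

End RealImaginaryParts.

(** * A monotone class principle on the dual group *)

Section IndicatorPolynomial.
Variable R : realType.

(* On the unit interval these polynomials tend pointwise to the indicator of
   [t < 1/2]; the factor [n] in the exponent makes the limit vanish at 1/2. *)
Definition step_poly n (t : R) : R := (1 - t ^+ n) ^+ (n * 2 ^ n).

Lemma step_poly_ge0 n (t : R) : 0 <= t <= 1 -> 0 <= step_poly n t.
Proof. by move=> /andP[t0 t1]; rewrite exprn_ge0// subr_ge0 exprn_ile1. Qed.

Lemma step_poly_le1 n (t : R) : 0 <= t <= 1 -> step_poly n t <= 1.
Proof.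
move=> /andP[t0 t1]; rewrite exprn_ile1 ?subr_ge0 ?exprn_ile1//.
by rewrite gerBl exprn_ge0.
Qed.

Lemma bernoulli_inequality (x : R) n : -1 <= x -> 1 + n%:R * x <= (1 + x) ^+ n.
Proof.
move=> x1; elim: n => [|n IH]; first by rewrite mul0r addr0 expr0.
have x1' : 0 <= 1 + x by rewrite -lerBlDl sub0r.
rewrite exprSr; apply: le_trans (ler_wpM2r x1' IH).
rewrite -natr1 -subr_ge0 (_ : _ - _ = n%:R * x ^+ 2); last by ring.
by rewrite mulr_ge0// sqr_ge0.
Qed.

(** Write q = s^2. Then n q^n = (n s^n) s^n, and n s^n is bounded by 1/(1 - s), by induction on
    n. *)
Lemma cvg_natM_geometric (q : R) : 0 <= q < 1 -> (fun n => n%:R * q ^+ n) @ \oo --> (0 : R).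
Proof.
move=> /andP[q0 q1].
pose s := Num.sqrt q; have s0 : 0 <= s by exact: sqrtr_ge0.
have s1 : s < 1 by rewrite -sqrtr1 ltr_sqrt.
have qE : q = s ^+ 2 by rewrite sqr_sqrtr.
have ns n : n%:R * s ^+ n <= (1 - s)^-1.
  rewrite -[leRHS]mul1r ler_pdivlMr ?subr_gt0//.
  elim: n => [|n]; first by rewrite !mul0r.
  rewrite -natr1 exprS => IH.
  have sn0 : 0 <= s ^+ n by exact: exprn_ge0.
  have sn1 : s ^+ n <= 1 by rewrite exprn_ile1// ltW.
  have n0 : 0 <= n%:R :> R by [].
  have h1 : s * (n%:R * s ^+ n * (1 - s)) <= s * 1 by rewrite ler_wpM2l.
  have h2 : (1 - s) * (s * s ^+ n) <= (1 - s) * 1.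
    by rewrite ler_wpM2l ?subr_ge0 ?mulr_ile1// ltW.
  lra.
have h : (fun n => (1 - s)^-1 * s ^+ n) @ \oo --> (0 : R).
  rewrite -(mulr0 (1 - s)^-1); apply: cvgMl_tmp; apply: cvg_expr.
  by rewrite ger0_norm.
apply: (squeeze_cvgr _ (cvg_cst (0 : R)) h); apply: nearW => n /=.
rewrite mulr_ge0 ?exprn_ge0//= qE -exprM mul2n -addnn exprD mulrA.
by rewrite ler_wpM2r ?exprn_ge0.
Qed.

(** Bernoulli's inequality serves twice. For t < 1/2 it bounds the polynomial below by 1 - n (2t)^n.
    For t >= 1/2, 1 - t^n <= 1/(1 + t^n) bounds it above by 1/(1 + n 2^n t^n), which is at most 1/(n
    + 1) because (2t)^n >= 1. *)
Lemma step_poly_cvg (t : R) : 0 <= t <= 1 ->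
  (fun n => step_poly n t) @ \oo --> (((t < 2^-1)%R)%:R : R).
Proof.
move=> t01; have /andP[t0 t1] := t01.
have [tlt|tge] := ltP t 2^-1; rewrite ?mulr1n ?mulr0n.
  have h : (fun n => 1 - n%:R * (2 * t) ^+ n) @ \oo --> (1 : R).
    rewrite -[X in _ --> X]subr0; apply: cvgB; first exact: cvg_cst.
    apply: cvg_natM_geometric; rewrite mulr_ge0//=.
    by rewrite -ltr_pdivlMl// mulr1.
  apply: (squeeze_cvgr _ h (cvg_cst (1 : R))); apply: nearW => n /=.
  rewrite step_poly_le1// andbT.
  have := @bernoulli_inequality (- t ^+ n) (n * 2 ^ n); rewrite mulrN lerN2 exprn_ile1// => /(_ isT).
  apply: le_trans; rewrite lerB//.
  by rewrite exprMn natrM natrX mulrA.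
have h : (fun n => n.+1%:R^-1) @ \oo --> (0 : R) by exact: cvg_harmonic.
apply: (squeeze_cvgr _ (cvg_cst (0 : R)) h); apply: nearW => n /=.
rewrite step_poly_ge0//=.
have tn0 : 0 <= t ^+ n by rewrite exprn_ge0.
have tn1 : 0 < 1 + t ^+ n by rewrite ltr_pwDl.
apply: (@le_trans _ _ ((1 + t ^+ n) ^- (n * 2 ^ n))).
  rewrite /step_poly -exprVn; apply: lerXn2r.
  - by rewrite nnegrE subr_ge0 exprn_ile1.
  - by rewrite nnegrE invr_ge0 ltW.
  rewrite -[leRHS]div1r ler_pdivlMr// -subr_sqr expr1n gerBl sqr_ge0//.
rewrite lef_pV2 ?posrE ?exprn_gt0//.
apply: le_trans (bernoulli_inequality _ _); last by rewrite (le_trans _ tn0)// lerN10.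
rewrite -natr1 addrC lerD2l natrM -mulrA ler_peMr ?ler0n//.
rewrite natrX -exprMn exprn_ege1// -ler_pdivrMl// mulr1//.
Qed.

End IndicatorPolynomial.

Section MonotoneClass.
Variables (R : realType) (Gamma : zmodType).
Hypothesis Gamma_countable : countable [set: Gamma].
Local Notation D := (dual_group R Gamma).

Lemma continuous_measurable (f : D -> R) : continuous f -> measurable_fun [set: D] f.
Proof.
move=> /continuousP cf; apply: (measurability _ (RGenOpens.measurableE R)).
move=> _ [_ [a [b ->] <-]]; rewrite setTI; apply: sub_sigma_algebra.
exact/cf/interval_open.
Qed.

(** Real trigonometric polynomials, generated inductively so that a property stable under linear
    combinations passes to all of them by [elim]. *)
Inductive trig_poly : (D -> R) -> Prop :=
| trig_re g : trig_poly (re_char g)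
| trig_im g : trig_poly (im_char g)
| trig_lin a f h : trig_poly f -> trig_poly h ->
    trig_poly (fun chi => a * f chi + h chi).

Lemma trig_cst a : trig_poly (fun=> a).
Proof.
rewrite (_ : (fun=> a) = (fun chi => a * re_char 0 chi + (0 * re_char 0 chi + im_char 0 chi))).
  by apply: trig_lin; [exact: trig_re|apply: trig_lin; [exact: trig_re|exact: trig_im]].
apply/funext => chi; rewrite /re_char /im_char dual_eval0/=.
by rewrite mulr1 mul0r !addr0.
Qed.

Lemma trig_scale a f : trig_poly f -> trig_poly (fun chi => a * f chi).
Proof.
move=> tf; rewrite (_ : (fun _ => _) = (fun chi => a * f chi + 0)).
  by apply: trig_lin => //; exact: trig_cst.
by apply/funext => chi; rewrite addr0.
Qed.

Lemma trig_add f h : trig_poly f -> trig_poly h -> trig_poly (fun chi => f chi + h chi).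
Proof.
move=> tf th; rewrite (_ : (fun _ => _) = (fun chi => 1 * f chi + h chi)).
  exact: trig_lin.
by apply/funext => chi; rewrite mul1r.
Qed.

(** The product-to-sum formulas of trigonometry, with h + g and h - g for the sum and difference of
    angles. *)
Lemma trig_mul_char f g : trig_poly f ->
  trig_poly (fun chi => f chi * re_char g chi) /\
  trig_poly (fun chi => f chi * im_char g chi).
Proof.
elim=> {f} [h|h|a f k _ [IHf1 IHf2] _ [IHk1 IHk2]].
- split.
  + rewrite (_ : (fun _ => _) = (fun chi =>
      2^-1 * re_char (h + g) chi + 2^-1 * re_char (h - g) chi)).
      by apply: trig_add; apply: trig_scale; exact: trig_re.
    by apply/funext => chi; rewrite !re_charD re_charN im_charN; field.
  + rewrite (_ : (fun _ => _) = (fun chi =>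
      2^-1 * im_char (h + g) chi + (- 2^-1) * im_char (h - g) chi)).
      by apply: trig_add; apply: trig_scale; exact: trig_im.
    by apply/funext => chi; rewrite !im_charD re_charN im_charN; field.
- split.
  + rewrite (_ : (fun _ => _) = (fun chi =>
      2^-1 * im_char (h + g) chi + 2^-1 * im_char (h - g) chi)).
      by apply: trig_add; apply: trig_scale; exact: trig_im.
    by apply/funext => chi; rewrite !im_charD re_charN im_charN; field.
  + rewrite (_ : (fun _ => _) = (fun chi =>
      (- 2^-1) * re_char (h + g) chi + 2^-1 * re_char (h - g) chi)).
      by apply: trig_add; apply: trig_scale; exact: trig_re.
    by apply/funext => chi; rewrite !re_charD re_charN im_charN; field.
- split.
  + rewrite (_ : (fun _ => _) = (fun chi =>
      a * (f chi * re_char g chi) + k chi * re_char g chi)); first exact: trig_lin.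
    by apply/funext => chi; rewrite mulrDl mulrA.
  + rewrite (_ : (fun _ => _) = (fun chi =>
      a * (f chi * im_char g chi) + k chi * im_char g chi)); first exact: trig_lin.
    by apply/funext => chi; rewrite mulrDl mulrA.
Qed.

Lemma trig_mul f h : trig_poly f -> trig_poly h -> trig_poly (fun chi => f chi * h chi).
Proof.
move=> tf; elim=> {h} [g|g|a h k _ IHh _ IHk].
- by have [] := trig_mul_char g tf.
- by have [] := trig_mul_char g tf.
- rewrite (_ : (fun _ => _) = (fun chi => a * (f chi * h chi) + f chi * k chi)).
    exact: trig_lin.
  by apply/funext => chi; rewrite mulrDr mulrCA.
Qed.

Lemma trig_exp f n : trig_poly f -> trig_poly (fun chi => f chi ^+ n).
Proof.
move=> tf; elim: n => [|n IH]; first exact: trig_cst.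
by under eq_fun do rewrite exprS; exact: trig_mul.
Qed.

(* [(g, (a, b, c))] encodes the half-space [a Re chi(g) + b Im chi(g) < c]; the
   coefficients are rational so that there are countably many cylinders. *)
Let halfspace : Type := (Gamma * (rat * rat * rat))%type.
Implicit Types (p : halfspace) (w : seq halfspace).

Definition linear_part p (chi : D) : R :=
  ratr p.2.1.1 * re_char p.1 chi + ratr p.2.1.2 * im_char p.1 chi.

Definition cylinder w : set D :=
  [set chi | forall p, p \in w -> linear_part p chi < ratr p.2.2].

(** An affine change of scale that turns the half-space condition into [< 1/2] with values in [0,1],
    as [step_poly] requires. The sum of absolute values bounds the linear form because both parts of
    a character are at most 1 in modulus; the added 1 keeps the denominator positive. *)
Let rescaled p (chi : D) : R :=
  2^-1 + (2 * (`|ratr p.2.1.1| + `|ratr p.2.1.2| + `|ratr p.2.2| + 1))^-1 *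
         (linear_part p chi - ratr p.2.2).

Let rescaled_itv p chi : 0 <= rescaled p chi <= 1.
Proof.
rewrite /rescaled /linear_part; case: p => g [[a b] c] /=.
set a' := ratr a; set b' := ratr b; set c' := ratr c.
set B := `|a'| + _ + _ + 1.
have B0 : 0 < B by rewrite ltr_wpDl// !addr_ge0.
have : `|a' * re_char g chi + b' * im_char g chi - c'| <= B.
  rewrite (le_trans (ler_normB _ _))// ler_wpDr// lerD2r.
  rewrite (le_trans (ler_normD _ _))// !normrM lerD//.
    by rewrite ler_piMr// normr_re_char.
  by rewrite ler_piMr// normr_im_char.
set z := _ - c'; rewrite ler_norml => /andP[h1 h2].
have e : (2 * B)^-1 * z = 2^-1 * (z / B) by rewrite invfM -mulrA [_^-1 * z]mulrC.
have h3 : -1 <= z / B by rewrite ler_pdivlMr// mulN1r.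
have h4 : z / B <= 1 by rewrite ler_pdivrMr// mul1r.
by rewrite e; apply/andP; split; lra.
Qed.

Let rescaled_lt p chi : (rescaled p chi < 2^-1) = (linear_part p chi < ratr p.2.2).
Proof.
by rewrite /rescaled -ltrBrDl subrr pmulr_rlt0 ?subr_lt0// invr_gt0 mulr_gt0.
Qed.

Let cylinder_approx n w chi : R := \prod_(p <- w) step_poly n (rescaled p chi).

Let cylinder_approx_itv n w chi : 0 <= cylinder_approx n w chi <= 1.
Proof.
apply/andP; split.
  by apply: prodr_ge0 => p _; apply: step_poly_ge0; exact: rescaled_itv.
rewrite /cylinder_approx; elim: w => [|p w IH]; first by rewrite big_nil.
rewrite big_cons mulr_ile1 ?step_poly_ge0 ?step_poly_le1 ?rescaled_itv//.
by apply: prodr_ge0 => q _; apply: step_poly_ge0; exact: rescaled_itv.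
Qed.

Let trig_cylinder_approx n w : trig_poly (cylinder_approx n w).
Proof.
elim: w => [|p w IH].
  rewrite (_ : cylinder_approx _ _ = fun=> 1); first exact: trig_cst.
  by apply/funext => chi; rewrite /cylinder_approx big_nil.
rewrite (_ : cylinder_approx _ _ = fun chi =>
    step_poly n (rescaled p chi) * cylinder_approx n w chi); last first.
  by apply/funext => chi; rewrite /cylinder_approx big_cons.
apply: trig_mul => //; rewrite /step_poly; apply: trig_exp.
apply: trig_add; first exact: trig_cst.
under eq_fun do rewrite -mulN1r.
apply: trig_scale; apply: trig_exp; rewrite /rescaled.
apply: trig_add; first exact: trig_cst.
apply: trig_scale; apply: trig_add; last exact: trig_cst.
by apply: trig_add; apply: trig_scale; [exact: trig_re|exact: trig_im].
Qed.

Let cylinder_approx_cvg w chi :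
  (fun n => cylinder_approx n w chi) @ \oo --> (\1_(cylinder w) chi : R).
Proof.
elim: w => [|p w IH].
  rewrite (_ : \1_ _ _ = 1 :> R); last by rewrite indicE mem_set.
  by under eq_fun do rewrite /cylinder_approx big_nil; exact: cvg_cst.
rewrite (_ : \1_(cylinder (p :: w)) chi =
    (rescaled p chi < 2^-1)%R%:R * \1_(cylinder w) chi :> R); last first.
  rewrite rescaled_lt !indicE -natrM mulnb; congr (_%:R); congr nat_of_bool.
  apply/idP/andP => [/set_mem h|[h1 /set_mem h2]].
    split; first by apply: h; rewrite mem_head.
    by apply/mem_set => q qw; apply: h; rewrite inE qw orbT.
  by apply/mem_set => q; rewrite inE => /orP[/eqP->//|]; exact: h2.
under eq_fun do rewrite /cylinder_approx big_cons.
by apply: cvgM => //; apply: step_poly_cvg; exact: rescaled_itv.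
Qed.

Lemma cylinder_cat w w' : cylinder (w ++ w') = cylinder w `&` cylinder w'.
Proof.
apply/seteqP; split => chi /=.
  by move=> h; split => p pw; apply: h; rewrite mem_cat pw ?orbT.
by move=> [h h'] p; rewrite mem_cat => /orP[]; [exact: h|exact: h'].
Qed.

Let cylinderI : setI_closed (range cylinder).
Proof.
move=> _ _ [w _ <-] [w' _ <-]; exists (w ++ w') => //.
exact: cylinder_cat.
Qed.

Lemma continuous_linear_part p : continuous (linear_part p).
Proof.
move=> chi.
have h1 : ratr p.2.1.1 * re_char p.1 xi @[xi --> chi] --> (ratr p.2.1.1 * re_char p.1 chi : R).
  exact: cvgM (cvg_cst _) (@re_char_continuous _ _ p.1 chi).
have h2 : ratr p.2.1.2 * im_char p.1 xi @[xi --> chi] --> (ratr p.2.1.2 * im_char p.1 chi : R).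
  exact: cvgM (cvg_cst _) (@im_char_continuous _ _ p.1 chi).
exact: cvgD h1 h2.
Qed.

Let cylinder_measurable w : measurable (cylinder w).
Proof.
rewrite (_ : cylinder w = \big[setI/setT]_(p <- w) [set chi | linear_part p chi < ratr p.2.2]).
  apply: big_ind => //; first exact: measurableI.
  move=> p _; rewrite -[X in measurable X]setTI.
  rewrite [X in _ `&` X](_ : _ = linear_part p @^-1` `]-oo, (ratr p.2.2)[); last first.
    by apply/seteqP; split => chi /=; rewrite in_itv.
  exact: continuous_measurable (@continuous_linear_part p) _ _ _.
rewrite -bigcap_seq; apply/seteqP; split => chi h p; exact: h.
Qed.

(** The supersets of cylinders around chi form a filter along which every real and imaginary part of
    a character converges to its value at chi. By [dual_cvgP] this filter converges to chi, hence
    contains U. *)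
Lemma open_cylinderP (U : set D) chi : open U -> U chi ->
  exists w, cylinder w chi /\ cylinder w `<=` U.
Proof.
move=> oU Uchi.
pose F : set_system D := [set A | exists w, cylinder w chi /\ cylinder w `<=` A].
have FF : Filter F.
  split.
  - by exists [::]; split.
  - move=> A B [w [wc wA]] [w' [w'c w'B]]; exists (w ++ w').
    by rewrite cylinder_cat; split; [split|exact: setISS].
  - by move=> A B AB [w [wc wA]]; exists w; split => //; exact: subset_trans AB.
have key g a b (l : D -> R) : (forall xi, l xi = ratr a * re_char g xi + ratr b * im_char g xi) ->
    l @ F --> l chi.
  move=> lE; apply/cvgrPdist_lt => e e0.
  (* Rationals c slightly above l(chi) and d slightly above -l(chi) give the two half-spaces -d < l
     < c, all within e of l(chi). *)
  have [c] := rat_in_itvoo (ltr_pwDr e0 (lexx (l chi))).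
  rewrite in_itv/= => /andP[c1 c2].
  have [d] := rat_in_itvoo (ltr_pwDr e0 (lexx (- l chi))).
  rewrite in_itv/= => /andP[d1 d2].
  exists [:: (g, (a, b, c)); (g, (- a, - b, d))]; split.
    move=> p; rewrite !inE => /orP[/eqP->|/eqP->]; rewrite /linear_part/= -?lE//.
    by rewrite !rmorphN !mulNr -opprD -lE.
  move=> xi /= h.
  have := h (g, (a, b, c)); rewrite mem_head /linear_part/= -lE => /(_ isT) h1.
  have := h (g, (- a, - b, d)); rewrite !inE eqxx orbT /linear_part/= => /(_ isT).
  rewrite !rmorphN !mulNr -opprD -lE => h2.
  by rewrite ltr_norml; apply/andP; split; lra.
suff : F --> chi by move=> /(_ U); apply; exact: open_nbhs_nbhs.
apply: dual_cvgP => g.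
  by apply: (key g 1 0) => xi; rewrite rmorph1 rmorph0 mul1r mul0r addr0.
by apply: (key g 0 1) => xi; rewrite rmorph1 rmorph0 mul1r mul0r add0r.
Qed.

(** Here countability of Gamma enters: with Gamma injected into the naturals, lists of rational
    half-spaces are coded by naturals, so an open set is a countable union of the cylinders that it
    contains. *)
Let measurable_cylinderE : @measurable _ D = <<s range cylinder >>.
Proof.
apply/seteqP; split; last first.
  apply: smallest_sub; first exact: sigma_algebra_measurable.
  by move=> _ [w _ <-].
apply: smallest_sub; first exact: smallest_sigma_algebra.
move=> U oU.
have /countable_injP[f finj] := Gamma_countable.
pose e n := xget 0 [set g | f g = n].
have eK g : e (f g) = g.
  rewrite /e; case: xgetP => [h _ /= fh|/(_ g)/(_ erefl)//].
  by apply: finj; rewrite ?inE.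
pose dec n : seq halfspace := if unpickle n is Some s
  then [seq (e q.1, q.2) | q <- (s : seq (nat * (rat * rat * rat)))] else [::].
have -> : U = \bigcup_n (if `[< cylinder (dec n) `<=` U >] then cylinder (dec n) else set0).
  apply/seteqP; split => [chi Uchi|chi [n _]]; last by case: asboolP => // + ?; exact.
  have [w [wc wU]] := open_cylinderP oU Uchi.
  pose n := pickle [seq (f q.1, q.2) | q <- w].
  have dn : dec n = w.
    rewrite /dec /n pickleK -map_comp -[RHS]map_id; apply: eq_map => -[g q] /=.
    by rewrite eK.
  by exists n => //; rewrite dn; case: asboolP.
have [s0 sC sU] := @smallest_sigma_algebra _ setT (range cylinder).
apply: sU => n; case: asboolP => _; last exact: s0.
by apply: sub_sigma_algebra; exists (dec n).
Qed.

Section Induction.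
Variable P : (D -> R) -> Prop.
Hypothesis P_re : forall g, P (re_char g).
Hypothesis P_im : forall g, P (im_char g).
Hypothesis P_lin : forall a f h, P f -> P h -> P (fun chi => a * f chi + h chi).
Hypothesis P_lim : forall (u : nat -> D -> R) f,
  (forall n, P (u n)) -> (forall n chi, 0 <= u n chi <= 1) ->
  (forall chi, (fun n => u n chi) @ \oo --> f chi) -> P f.

(** Dynkin's theorem for the cylinders, which are closed under intersection. Their indicators are
    limits of trigonometric polynomials; complements are linear combinations and disjoint unions are
    limits. Limits are only asked for sequences with values in [0,1], so that dominated convergence
    can supply [P_lim]. *)
Lemma indicator_induction A : measurable A -> P \1_A.
Proof.
have P_trig f : trig_poly f -> P f by elim=> // a {}f h _ Pf _ Ph; exact: P_lin.
have P0 : P (fun=> 0) by apply: P_trig; exact: trig_cst.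
have P1 : P (fun=> 1) by apply: P_trig; exact: trig_cst.
rewrite measurable_cylinderE; move: A.
apply: (@dynkin_induction _ D _ (fun A => P \1_A) measurable_cylinderE cylinderI).
- by rewrite indicT.
- move=> _ [w _ <-]; apply: (P_lim (u := fun n => cylinder_approx n w)) => //.
  by move=> n; apply: P_trig; exact: trig_cylinder_approx.
- move=> S mS PS.
  rewrite (_ : \1_(~` S) = fun chi => -1 * \1_S chi + 1); first exact: P_lin.
  apply/funext => chi; rewrite !indicE in_setC; case: (chi \in S) => /=; rewrite ?mulr1n ?mulr0n; ring.
- move=> F mF tF PF.
  (* Disjointness makes every partial sum 0 or 1, which is the bound that [P_lim] asks for. *)
  have sumE chi : (exists k, F k chi /\
      forall n, \sum_(i < n) \1_(F i) chi = (k < n)%N%:R :> R) \/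
      ((forall k, ~ F k chi) /\ forall n, \sum_(i < n) \1_(F i) chi = 0 :> R).
    have [[k Fk]|nF] := pselect (exists k, F k chi); [left; exists k|right].
      split => // n.
      have FE i : \1_(F i) chi = (i == k)%:R :> R.
        rewrite indicE; have [->|ik] := eqVneq i k; first by rewrite mem_set.
        rewrite memNset// => Fi; move/eqP: ik; apply.
        by apply: tF => //; exists chi.
      under eq_bigr do rewrite FE.
      elim: n => [|n IH]; first by rewrite big_ord0.
      rewrite big_ord_recr/= IH [in RHS]ltnS [in RHS]leq_eqVlt [n == k]eq_sym.
      by case: (eqVneq k n) => [->|kn] /=; rewrite ?ltnn ?mulr0n ?add0r ?addr0.
    split=> [k Fk|n]; first by apply: nF; exists k.
    rewrite big1// => i _; rewrite indicE memNset// => Fi; apply: nF; by exists i.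
  apply: (P_lim (u := fun n chi => \sum_(k < n) \1_(F k) chi)).
  + elim=> [|n IH]; first by under eq_fun do rewrite big_ord0.
    rewrite (_ : (fun _ => _) = fun chi =>
      1 * \1_(F n) chi + \sum_(k < n) \1_(F k) chi); first exact: P_lin.
    by apply/funext => chi; rewrite big_ord_recr/= mul1r addrC.
  + by move=> n chi; have [[k [_ ->]]|[_ ->]] := sumE chi; rewrite ?lexx ?ler01// ler0n lern1 leq_b1.
  + move=> chi; have [[k [Fk sE]]|[nF sE]] := sumE chi.
      rewrite indicE mem_set; last by exists k.
      apply: cvg_near_cst; exists k.+1 => // n /= kn; by rewrite sE kn.
    rewrite indicE memNset; last by move=> [k _]; exact: nF.
    by apply: cvg_near_cst; apply: nearW => n; rewrite sE.
Qed.

End Induction.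
End MonotoneClass.

(** * Integration against Haar measure *)

Section RealIntegrals.
Context d (T : measurableType d) (R : realType) (mu : {measure set T -> \bar R}).
Local Notation integ f := (mu.-integrable [set: T] (EFin \o f)).
Implicit Types f b : T -> R.

Lemma integrable_bounded_mul b f (M : R) : measurable_fun [set: T] b ->
  (forall x, `|b x| <= M) -> integ f -> integ (fun x => b x * f x).
Proof.
move=> mb bM fi.
have : mu.-integrable [set: T] ((EFin \o b) \* (EFin \o f))%E.
  apply: integrableMr => //; exists M; split; first exact: num_real.
  by move=> y My x _; apply: le_trans (bM x) (ltW My).
by apply: eq_integrable => // x _ /=; rewrite EFinM.
Qed.

Lemma integrable_lin (a : R) f b : integ f -> integ b ->
  integ (fun x => a * f x + b x).
Proof.
move=> fi bi.
have := integrableD measurableT (integrableZl measurableT a fi) bi.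
by apply: eq_integrable => // x _ /=; rewrite EFinD EFinM.
Qed.

Lemma Rintegral_lin (a : R) f b : integ f -> integ b ->
  \int[mu]_x (a * f x + b x) = a * \int[mu]_x f x + \int[mu]_x b x.
Proof.
move=> fi bi; rewrite RintegralD ?RintegralZl//.
have := integrableZl measurableT a fi.
by apply: eq_integrable => // x _ /=; rewrite EFinM.
Qed.

Lemma Rintegral_dominated_cvg (u : nat -> T -> R) f g :
  (forall n, measurable_fun [set: T] (u n)) -> measurable_fun [set: T] f ->
  {ae mu, forall x, u n x @[n --> \oo] --> f x} ->
  integ g -> {ae mu, forall x n, `|u n x| <= g x} ->
  \int[mu]_x u n x @[n --> \oo] --> \int[mu]_x f x.
Proof.
move=> mu_ mf uf gi ug.
have [] := @dominated_convergence _ _ _ mu setT measurableT (fun n => EFin \o u n) (EFin \o f) (EFin \o g).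
- by move=> n; apply/measurable_EFinP.
- exact/measurable_EFinP.
- by apply: filterS uf => x h _; apply: cvg_EFin h; exact: nearW.
- exact: gi.
- by apply: filterS ug => x h n _; rewrite /= lee_fin.
move=> fi _ h.
have /fine_cvg : (\int[mu]_x (u n x)%:E)%E @[n --> \oo] --> ((\int[mu]_x f x)%:E)%E.
  by rewrite /Rintegral fineK//; exact: integrable_fin_num.
by [].
Qed.

Lemma Rintegral_indic_mul A f : measurable A ->
  \int[mu]_x (\1_A x * f x) = \int[mu]_(x in A) f x.
Proof.
move=> mA; rewrite [RHS]Rintegral_mkcond; apply: eq_Rintegral => x _.
by rewrite patchE indicE; case: ifP => /= _; rewrite ?mul1r ?mul0r.
Qed.

Lemma Rintegral_eq0_ae f : integ f ->
  (forall A, measurable A -> \int[mu]_x (\1_A x * f x) = 0) ->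
  {ae mu, forall x, f x = 0}.
Proof.
move=> fi f0.
have : ae_eq mu setT (EFin \o f) (cst 0%E).
  apply: integral_ae_eq => //.
  move=> E _ mE; rewrite integral0.
  have fE : mu.-integrable E (EFin \o f) by exact: integrableS fi.
  rewrite -[LHS]fineK; last exact: integrable_fin_num.
  by rewrite -[fine _]/(Rintegral mu E f) -Rintegral_indic_mul// f0.
by apply: filterS => x /(_ I) [].
Qed.

End RealIntegrals.

Section MeasurePreserving.
Context d (T : measurableType d) (R : realType) (mu : {measure set T -> \bar R}).
Variable phi : T -> T.
Hypothesis mphi : measurable_fun [set: T] phi.
Hypothesis phi_mu : forall A, measurable A -> mu (phi @^-1` A) = mu A.

Lemma ae_preserving (P : T -> Prop) : {ae mu, forall x, P x} ->
  {ae mu, forall x, P (phi x)}.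
Proof.
move=> [A [mA A0 PA]]; exists (phi @^-1` A); split.
- by rewrite -[X in measurable X]setTI; exact: mphi.
- by rewrite phi_mu.
- by move=> x /= nP; exact: PA.
Qed.

Lemma integrable_preserving (f : T -> R) :
  mu.-integrable [set: T] (EFin \o f) -> mu.-integrable [set: T] (EFin \o (f \o phi)).
Proof.
move=> /integrableP[mf fi]; apply/integrableP; split.
  exact: measurableT_comp mf mphi.
rewrite -(preimage_setT phi).
rewrite -(@ge0_integral_pushforward _ _ _ _ _ phi mphi mu setT
  (fun x => `|(f x)%:E|%E))//; last exact: measurableT_comp.
by rewrite (eq_measure_integral mu)// => A mA _; exact: phi_mu.
Qed.

Lemma Rintegral_preserving (f : T -> R) :
  mu.-integrable [set: T] (EFin \o f) -> \int[mu]_x f (phi x) = \int[mu]_x f x.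
Proof.
move=> fi; rewrite /Rintegral; congr fine.
transitivity (\int[pushforward mu phi]_x (f x)%:E)%E; last first.
  by apply: eq_measure_integral => A mA _; exact: phi_mu.
rewrite (@integral_pushforward _ _ _ _ _ phi mphi mu setT (EFin \o f))//.
- exact: measurable_int fi.
- exact: integrable_preserving.
Qed.

End MeasurePreserving.

(** * Uniqueness of Fourier coefficients and invariance of Haar measure *)

Section FourierUniqueness.
Variables (R : realType) (Gamma : zmodType).
Hypothesis Gamma_countable : countable [set: Gamma].
Local Notation D := (dual_group R Gamma).
Variable lambda : probability D R.
Local Notation integ f := (lambda.-integrable [set: D] (EFin \o f)).
Implicit Types f h u : D -> R.

Let bounded_measurable f : Prop :=
  measurable_fun [set: D] f /\ exists M, forall chi, `|f chi| <= M.

Lemma measurable_re_char g : measurable_fun [set: D] (re_char g).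
Proof. exact: continuous_measurable (@re_char_continuous R Gamma g). Qed.

Lemma measurable_im_char g : measurable_fun [set: D] (im_char g).
Proof. exact: continuous_measurable (@im_char_continuous R Gamma g). Qed.

Let bm_re g : bounded_measurable (re_char g).
Proof.
by split; [exact: measurable_re_char|exists 1 => chi; exact: normr_re_char].
Qed.

Let bm_im g : bounded_measurable (im_char g).
Proof.
by split; [exact: measurable_im_char|exists 1 => chi; exact: normr_im_char].
Qed.

Let bm_lin a f h : bounded_measurable f -> bounded_measurable h ->
  bounded_measurable (fun chi => a * f chi + h chi).
Proof.
move=> [mf [M fM]] [mh [K hK]]; split.
  by apply: measurable_funD => //; apply: measurable_funM.
exists (`|a| * M + K) => chi.
by rewrite (le_trans (ler_normD _ _))// normrM lerD// ler_wpM2l.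
Qed.

Let bm_lim (v : nat -> D -> R) f : (forall n, bounded_measurable (v n)) ->
  (forall n chi, 0 <= v n chi <= 1) ->
  (forall chi, (fun n => v n chi) @ \oo --> f chi) -> bounded_measurable f.
Proof.
move=> bv v01 vf; split.
  apply: (@measurable_fun_cvg _ _ _ _ v) => // n; exact: (bv n).1.
exists 1 => chi.
have h : `|v n chi| @[n --> \oo] --> `|f chi| by exact: cvg_norm.
rewrite -(cvg_lim _ h)//; apply: limr_le; first by apply/cvg_ex; exists `|f chi|.
by apply: nearW => n; have /andP[v0 v1] := v01 n chi; rewrite ger0_norm.
Qed.

Let bm_integrable_mul f h : bounded_measurable f -> integ h -> integ (fun chi => f chi * h chi).
Proof. by move=> [mf [M fM]]; exact: integrable_bounded_mul fM. Qed.

Lemma integrable_constant a : integ (fun=> a).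
Proof. exact: finite_measure_integrable_cst. Qed.

Let functional_lim (v : nat -> D -> R) f h : integ h ->
  (forall n, bounded_measurable (v n)) ->
  (forall n chi, 0 <= v n chi <= 1) ->
  (forall chi, (fun n => v n chi) @ \oo --> f chi) ->
  \int[lambda]_x (v n x * h x) @[n --> \oo] --> \int[lambda]_x (f x * h x).
Proof.
move=> hi bv v01 vf.
have mh : measurable_fun [set: D] h by apply/measurable_EFinP; exact: measurable_int hi.
apply: (@Rintegral_dominated_cvg _ _ _ lambda _ _ (fun x => `|h x|)).
- by move=> n; apply: measurable_funM => //; exact: (bv n).1.
- by apply: measurable_funM => //; exact: (bm_lim bv v01 vf).1.
- by apply: aeW => x; apply: cvgM => //; exact: cvg_cst.
- exact: integrable_norm.
- apply: aeW => x n; have /andP[v0 v1] := v01 n x.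
  by rewrite normrM ger0_norm// ler_piMl.
Qed.

(** The bounded measurable f with zero integral against h satisfy the closure conditions of
    [indicator_induction], so h integrates to zero over every Borel set. *)
Lemma fourier_uniqueness h : integ h ->
  (forall g, \int[lambda]_x (re_char g x * h x) = 0) ->
  (forall g, \int[lambda]_x (im_char g x * h x) = 0) ->
  {ae lambda, forall x, h x = 0}.
Proof.
move=> hi hre him; apply: Rintegral_eq0_ae => // A mA.
pose P f := bounded_measurable f /\ \int[lambda]_x (f x * h x) = 0.
suff : P \1_A by case.
apply: (indicator_induction Gamma_countable) => //.
- move=> a f k [bf f0] [bk k0]; split; first exact: bm_lin.
  under eq_Rintegral do rewrite mulrDl -mulrA.
  by rewrite Rintegral_lin ?f0 ?k0 ?mulr0 ?addr0//; exact: bm_integrable_mul.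
- move=> v f Pv v01 vf; have bv n := (Pv n).1; split; first exact: bm_lim vf.
  have := functional_lim hi bv v01 vf.
  under eq_fun do rewrite (Pv _).2.
  by move=> h0; apply/esym; apply: (cvg_unique _ (cvg_cst _) h0); exact: Rhausdorff.
Qed.

Lemma measurable_dual_map (phi : D -> D) :
  (forall g, measurable_fun [set: D] (re_char g \o phi)) ->
  (forall g, measurable_fun [set: D] (im_char g \o phi)) ->
  measurable_fun [set: D] phi.
Proof.
move=> mre mim _ A mA; rewrite setTI.
suff mAphi : measurable_fun [set: D] ((\1_A : D -> R) \o phi).
  have := mAphi measurableT [set 1] (measurable_set1 1); rewrite setTI.
  congr measurable; apply/seteqP; split => x /=; rewrite indicE.
    by case: (boolP (phi x \in A)) => [/set_mem//|_ /eqP]; rewrite eq_sym oner_eq0.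
  by move=> Ax; rewrite mem_set.
apply: (indicator_induction Gamma_countable (P := fun f => measurable_fun [set: D] (f \o phi))) => //.
- move=> a f h mf mh; rewrite (_ : _ \o phi = fun x => a * (f \o phi) x + (h \o phi) x)//.
  by apply: measurable_funD => //; apply: measurable_funM.
- move=> v f mv _ vf; apply: (@measurable_fun_cvg _ _ _ _ (fun n => v n \o phi)) => //.
  by move=> x _; exact: vf.
Qed.

Lemma measurable_translation (k : D) : measurable_fun [set: D] (fun xi : D => (k * xi)%g).
Proof.
have E g (xi : D) : dual_eval (k * xi)%g g = k g * xi g by [].
apply: measurable_dual_map => g.
- rewrite (_ : _ \o _ = fun xi => re_char g k * re_char g xi - im_char g k * im_char g xi).
    by apply: measurable_funB; apply: measurable_funM => //;
      [exact: measurable_re_char|exact: measurable_im_char].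
  apply/funext => xi; rewrite /re_char /im_char /= E.
  by case: (k g) => a b; case: (dual_eval xi g).
- rewrite (_ : _ \o _ = fun xi => re_char g k * im_char g xi + im_char g k * re_char g xi).
    by apply: measurable_funD; apply: measurable_funM => //;
      [exact: measurable_im_char|exact: measurable_re_char].
  apply/funext => xi; rewrite /re_char /im_char /= E.
  by case: (k g) => a b; case: (dual_eval xi g).
Qed.

Hypothesis lambda_haar : normalized_haar lambda.

Lemma haar_translation (k : D) A : measurable A ->
  lambda ((fun xi : D => (k * xi)%g) @^-1` A) = lambda A.
Proof.
move=> mA; rewrite -(lambda_haar k^-1%g mA); congr (lambda _).
apply/seteqP; split => xi /=; first by move=> h; exists (k * xi)%g => //; rewrite mulgA mulVg mul1g.
by move=> [x Ax <-]; rewrite mulgA mulgV mul1g.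
Qed.

(** Translating the variable by k multiplies the integral of xi(g) u(xi) by k(g) and, by Haar
    invariance, leaves it unchanged. *)
Lemma char_integral_eq0 (k : D) g u : integ u -> (forall xi, u (k * xi)%g = u xi) ->
  k g != 1 ->
  \int[lambda]_x (re_char g x * u x) = 0 /\ \int[lambda]_x (im_char g x * u x) = 0.
Proof.
move=> ui uk kg1.
have E (xi : D) : dual_eval (k * xi)%g g = k g * xi g by [].
have mt := measurable_translation k.
have ht := haar_translation k.
have ire : integ (fun x => re_char g x * u x) by exact: bm_integrable_mul.
have iim : integ (fun x => im_char g x * u x) by exact: bm_integrable_mul.
pose a := re_char g k; pose b := im_char g k.
have e1 := Rintegral_preserving mt ht ire.
have e2 := Rintegral_preserving mt ht iim.
move: e1 e2.
under eq_Rintegral => x _.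
  rewrite uk (_ : _ * _ = a * (re_char g x * u x) + (- b * (im_char g x * u x))); last first.
    rewrite /a /b /re_char /im_char E; case: (k g) => ? ?; case: (dual_eval x g) => ? ? /=; ring.
  over.
move=> e1.
under eq_Rintegral => x _.
  rewrite uk (_ : _ * _ = a * (im_char g x * u x) + (b * (re_char g x * u x))); last first.
    rewrite /a /b /re_char /im_char E; case: (k g) => ? ?; case: (dual_eval x g) => ? ? /=; ring.
  over.
move: e1.
have izl c f : integ f -> integ (fun x => c * f x).
  by move=> fi; apply: bm_integrable_mul => //; split => //; exists `|c|.
rewrite !Rintegral_lin ?RintegralZl//; try exact: izl.
set I := Rintegral _ _ (fun x => re_char g x * u x).
set J := Rintegral _ _ (fun x => im_char g x * u x).
move=> e1 e2.
(* In real terms the two equations are a linear system in [I] and [J]; this is its determinant, the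
   squared modulus of 1 - k(g). *)
have c0 : (1 - a) ^+ 2 + b ^+ 2 != 0.
  rewrite paddr_eq0 ?sqr_ge0// !sqrf_eq0 subr_eq0; apply: contra kg1 => /andP[/eqP a1 /eqP b0].
  by rewrite eq_complex -/(re_char g k) -/(im_char g k) -/a -/b -a1 b0 /= !eqxx.
split; apply: (mulfI c0); rewrite mulr0.
  rewrite (_ : _ * I = (1 - a) * (I - (a * I + - b * J)) - b * (J - (a * J + b * I))); last by ring.
  by rewrite e1 e2 !subrr !mulr0 subrr.
rewrite (_ : _ * J = (1 - a) * (J - (a * J + b * I)) + b * (I - (a * I + - b * J))); last by ring.
by rewrite e1 e2 !subrr !mulr0 addr0.
Qed.

Section Endomorphism.
Variables (alpha : {additive Gamma -> Gamma}).
Local Notation astar := (@dual_endo R Gamma alpha).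
Hypothesis alpha_surj : forall chi : D, exists xi, astar xi = chi.

Lemma measurable_dual_endo : measurable_fun [set: D] astar.
Proof.
by apply: measurable_dual_map => g; [exact: measurable_re_char|exact: measurable_im_char].
Qed.

(** It suffices to compare integrals of characters. If some chi has chi(g) different from 1, then
    both integrals vanish: the one of xi(g) by translation by chi, the one of xi(alpha g) by
    translation by a preimage of chi. Otherwise both integrands are constant and equal. *)
Lemma haar_dual_endo A : measurable A -> lambda (astar @^-1` A) = lambda A.
Proof.
move=> mA.
have mastar := measurable_dual_endo.
have mpre : measurable (astar @^-1` A) by rewrite -[X in measurable X]setTI; exact: mastar.
have bm_comp f : bounded_measurable f -> bounded_measurable (f \o astar).
  move=> [mf [M fM]]; split; first exact: measurableT_comp mf mastar.
  by exists M => chi; exact: fM.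
(* The factor 1 gives these integrals the form f * u of [functional_lim] and [char_integral_eq0]. *)
pose P f := bounded_measurable f /\
  \int[lambda]_x (f x * 1) = \int[lambda]_x ((f \o astar) x * 1).
have i1 : integ (fun=> 1) by exact: integrable_constant.
suff [_] : P \1_A.
  have int1 B : measurable B -> \int[lambda]_x (\1_B x * 1) = fine (lambda B).
    by move=> mB; rewrite Rintegral_indic_mul// Rintegral_cst// mul1r.
  rewrite (_ : (\1_A \o astar) = \1_(astar @^-1` A))// !int1// => e.
  by rewrite -[LHS]fineK -?e ?fineK// fin_num_measure.
have triv g : (forall chi : D, chi g = 1) ->
    forall f, f = re_char g \/ f = im_char g -> forall x, f (astar x) = f x.
  by move=> gt f [->|->] x; rewrite /re_char /im_char !gt.
have key g : \int[lambda]_x (re_char g x * 1) = \int[lambda]_x ((re_char g \o astar) x * 1) /\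
    \int[lambda]_x (im_char g x * 1) = \int[lambda]_x ((im_char g \o astar) x * 1).
  have [gt|/existsNP[chi /eqP chig]] := pselect (forall chi : D, chi g = 1).
    by split; apply: eq_Rintegral => x _ /=; rewrite (triv g)//; [left|right].
  have [-> ->] := char_integral_eq0 i1 (fun=> erefl) chig.
  have [xi xiE] := alpha_surj chi.
  have xig : xi (alpha g) != 1 by rewrite -[xi _]/(astar xi g) xiE.
  by have [r i] := char_integral_eq0 i1 (fun=> erefl) xig; split; [rewrite -r|rewrite -i].
apply: (indicator_induction Gamma_countable _ _ _ _ mA).
- by move=> g; split; [exact: bm_re|have [] := key g].
- by move=> g; split; [exact: bm_im|have [] := key g].
- move=> a f h [bf ef] [bh eh]; split; first exact: bm_lin.
  have lin k l : bounded_measurable k -> bounded_measurable l ->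
      \int[lambda]_x ((a * k x + l x) * 1) = a * \int[lambda]_x (k x * 1) + \int[lambda]_x (l x * 1).
    move=> bk bl; under eq_Rintegral do rewrite mulrDl -mulrA.
    by rewrite Rintegral_lin//; exact: bm_integrable_mul.
  by rewrite lin// ef eh -lin//; exact: bm_comp.
- move=> v f Pv v01 vf; have bv n := (Pv n).1; split; first exact: bm_lim vf.
  have h1 := functional_lim i1 bv v01 vf.
  have h2 := @functional_lim (fun n => v n \o astar) (f \o astar) _ i1
    (fun n => bm_comp _ (bv n)) (fun n x => v01 n _) (fun x => vf _).
  move: h1; under eq_fun do rewrite (Pv _).2.
  by move=> h1; exact: cvg_unique h1 h2.
Qed.

End Endomorphism.

End FourierUniqueness.

(** * Orthogonality relations between the kernel of the dual endomorphism and the cosets of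
    alpha(Gamma) *)

Section KernelSums.
Variables (R : realType) (Gamma : zmodType).
Variables (alpha : {additive Gamma -> Gamma}) (N : nat).
Hypothesis alpha_index : (cosets alpha #= `I_N)%card.
Local Open Scope complex_scope.
Local Notation D := (dual_group R Gamma).
Local Notation astar := (@dual_endo R Gamma alpha).

Lemma kernel_enum : exists s : seq D,
  uniq s /\ forall k, k \in s <-> astar k = 1%g.
Proof.
have /finite_seqP[s sE] := @kernel_finite R _ _ _ alpha_index.
exists (undup s); split; first exact: undup_uniq.
by move=> k; rewrite mem_undup; move/seteqP : sE => [h1 h2]; split=> [/h2|/h1].
Qed.

Variable s : seq D.
Hypotheses (s_uniq : uniq s) (sP : forall k, k \in s <-> astar k = 1%g).

Lemma dual_endoM (k xi : D) : astar (k * xi)%g = (astar k * astar xi)%g.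
Proof. exact: dual_ext. Qed.

Lemma dual_endo_kernel (k xi : D) : k \in s -> astar (k * xi)%g = astar xi.
Proof. by move=> /sP k1; rewrite dual_endoM k1 mul1g. Qed.

Lemma kernel_mul (k k' : D) : k \in s -> k' \in s -> (k * k')%g \in s.
Proof. by move=> ks /sP k's; apply/sP; rewrite dual_endo_kernel. Qed.

Lemma kernel_inv (k : D) : k \in s -> k^-1%g \in s.
Proof.
move=> /sP k1; apply/sP; rewrite -[LHS]mul1g -{1}k1 -dual_endoM mulgV.
exact: dual_ext.
Qed.

Lemma kernel1 : 1%g \in s.
Proof. by apply/sP; exact: dual_ext. Qed.

Lemma size_kernel_gt0 : (0 < size s)%N.
Proof. by have := kernel1; case: s. Qed.

Lemma dual_endo_fiber (xi xi' : D) : astar xi' = astar xi ->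
  exists2 k, k \in s & xi' = (k * xi)%g.
Proof.
move=> e; exists (xi' * xi^-1)%g; last by rewrite -mulgA mulVg mulg1.
apply/sP; rewrite dual_endoM e -dual_endoM mulgV; exact: dual_ext.
Qed.

Lemma kernel_shift (V : nmodType) (F : D -> V) (k : D) : k \in s ->
  \sum_(k' <- s) F (k' * k)%g = \sum_(k' <- s) F k'.
Proof.
move=> ks; rewrite -(big_map (fun k' : D => (k' * k)%g) xpredT F).
apply: perm_big; apply: uniq_perm => //.
  by rewrite map_inj_uniq// => x y /(congr1 (fun z => z * k^-1)%g); rewrite -!mulgA mulgV !mulg1.
move=> x; apply/mapP/idP => [[y ys ->]|xs]; first exact: kernel_mul.
exists (x * k^-1)%g; first by rewrite kernel_mul// kernel_inv.
by rewrite -mulgA mulVg mulg1.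
Qed.

Variable r : 'I_N -> Gamma.
Hypothesis r_surj : forall x, exists l y, x = r l + alpha y.
Hypothesis r_inj : forall l l' y, r l = r l' + alpha y -> l = l'.

(** A kernel element depends only on the coset. Adding x permutes the cosets, which multiplies the
    sum by k(x); choose x with k(x) different from 1. *)
Lemma sum_kernel_char (k : D) : k \in s ->
  \sum_l k (r l) = if k == 1%g then N%:R else 0.
Proof.
move=> /sP k1; have [->|kn1] := eqVneq.
  by rewrite (eq_bigr (fun=> 1))// sumr_const card_ord.
have [x kx] : exists x, k x != 1.
  apply: contrapT => h; move/eqP: kn1; apply; apply: dual_ext => x.
  by apply: contrapT => /eqP kx; apply: h; exists x.
have /choice[f fP] : forall l, exists l', exists y, r l + x = r l' + alpha y.
  by move=> l; exact: r_surj.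
have finj : injective f.
  move=> l l' e; have [y ly] := fP l; have [y' ly'] := fP l'.
  apply: (r_inj (y := y - y')); apply: (addIr x).
  rewrite ly e raddfB -addrA [_ + x]addrC addrA ly'.
  by rewrite -addrA; congr (_ + _); rewrite addrC subrK.
have e : k x * \sum_l k (r l) = \sum_l k (r l).
  rewrite [RHS](reindex_inj finj)/= mulr_sumr; apply: eq_bigr => l _.
  have [y ly] := fP l; rewrite mulrC -dual_evalD ly dual_evalD.
  by rewrite -[k (alpha y)]/(astar k y) k1 mulr1.
have : (k x - 1) * \sum_l k (r l) = 0 by rewrite mulrBl e mul1r subrr.
by move/eqP; rewrite mulf_eq0 subr_eq0 (negbTE kx) => /eqP.
Qed.

Lemma sum_kernel_eq0 (k : D) x : k \in s -> k x != 1 -> \sum_(k' <- s) k' x = 0.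
Proof.
move=> ks kx.
have e : (\sum_(k' <- s) k' x) * k x = \sum_(k' <- s) k' x.
  rewrite -[RHS](kernel_shift (fun k' : D => k' x) ks) mulr_suml.
  by apply: eq_bigr => k' _.
have : (\sum_(k' <- s) k' x) * (k x - 1) = 0 by rewrite mulrBr e mulr1 subrr.
by move/eqP; rewrite mulf_eq0 subr_eq0 (negbTE kx) orbF => /eqP.
Qed.

Lemma dual_eval_inv (k : D) x : dual_eval k^-1%g x = Num.conj (k x).
Proof.
apply: (mulfI (dual_neq0 k x)); rewrite -normCK dual_norm expr1n.
exact: mulfV (dual_neq0 k x).
Qed.

(** Expand the squares and sum over l first. The values of xi cancel since they have modulus 1, and
    [sum_kernel_char] at k k'^-1 kills all off-diagonal terms. *)
Lemma kernel_plancherel (xi : D) (a : D -> R[i]) :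
  \sum_l `|\sum_(k <- s) dual_eval (k * xi)%g (r l) * Num.conj (a k)| ^+ 2 =
  N%:R * \sum_(k <- s) `|a k| ^+ 2.
Proof.
have E (k k' : D) l : dual_eval (k * xi)%g (r l) * Num.conj (a k) *
    Num.conj (dual_eval (k' * xi)%g (r l) * Num.conj (a k')) =
    Num.conj (a k) * a k' * dual_eval (k * k'^-1)%g (r l).
  rewrite -[dual_eval (k * xi)%g _]/(dual_eval k (r l) * dual_eval xi (r l)).
  rewrite -[dual_eval (k' * xi)%g _]/(dual_eval k' (r l) * dual_eval xi (r l)).
  rewrite -[dual_eval (k * _)%g _]/(dual_eval k (r l) * dual_eval k'^-1%g (r l)).
  rewrite dual_eval_inv !rmorphM/= conjCK.
  have x1 : xi (r l) * Num.conj (xi (r l)) = 1 by rewrite -normCK dual_norm expr1n.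
  rewrite -[RHS]mulr1 -x1; ring.
transitivity (\sum_(k <- s) \sum_(k' <- s) \sum_l
    Num.conj (a k) * a k' * dual_eval (k * k'^-1)%g (r l)).
  under eq_bigr do rewrite normCK rmorph_sum/= big_distrlr/=.
  rewrite exchange_big/=; apply: eq_bigr => k _.
  rewrite exchange_big/=; apply: eq_bigr => k' _.
  by apply: eq_bigr => l _; exact: E.
rewrite mulr_sumr; apply: eq_big_seq => k ks.
rewrite (bigD1_seq k)//= [X in _ + X]big_seq_cond [X in _ + X]big1 ?addr0.
  by rewrite -mulr_sumr mulgV sum_kernel_char ?kernel1// eqxx mulrC normCKC.
move=> k' /andP[k's k'k].
rewrite -mulr_sumr sum_kernel_char ?kernel_mul ?kernel_inv//.
case: eqP => [e|_]; last by rewrite mulr0.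
move/eqP: k'k; case; rewrite -[RHS]mulg1 -(mulVg k') mulgA e.
by rewrite mul1g.
Qed.

End KernelSums.

Section RintegralSum.
Context d (T : measurableType d) (R : realType) (mu : {measure set T -> \bar R}).

Lemma integrable_bigsum (I : eqType) (s : seq I) (f : I -> T -> R) :
  (forall i, i \in s -> mu.-integrable [set: T] (EFin \o f i)) ->
  mu.-integrable [set: T] (EFin \o (fun x => \sum_(i <- s) f i x)).
Proof.
elim: s => [|i s IH] fi.
  by under [X in EFin \o X]eq_fun do rewrite big_nil; exact: integrable0.
rewrite (_ : (fun x => _) = fun x => 1 * f i x + \sum_(j <- s) f j x); last first.
  by apply/funext => x; rewrite big_cons mul1r.
apply: integrable_lin; first by apply: fi; rewrite mem_head.
by apply: IH => j js; apply: fi; rewrite inE js orbT.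
Qed.

Lemma Rintegral_bigsum (I : eqType) (s : seq I) (f : I -> T -> R) :
  (forall i, i \in s -> mu.-integrable [set: T] (EFin \o f i)) ->
  \int[mu]_x (\sum_(i <- s) f i x) = \sum_(i <- s) \int[mu]_x f i x.
Proof.
elim: s => [|i s IH] fi.
  by rewrite big_nil; under eq_Rintegral do rewrite big_nil; rewrite /Rintegral integral0.
have fs j : j \in s -> mu.-integrable [set: T] (EFin \o f j).
  by move=> js; apply: fi; rewrite inE js orbT.
rewrite big_cons -IH//; under eq_Rintegral do rewrite big_cons.
rewrite RintegralD//; first by apply: fi; rewrite mem_head.
exact: integrable_bigsum.
Qed.

End RintegralSum.

(** * Descent along the dual endomorphism and transfer of densities *)

Section Transfer.
Variables (R : realType) (Gamma : zmodType).
Hypothesis Gamma_countable : countable [set: Gamma].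
Variables (alpha : {additive Gamma -> Gamma}) (N : nat).
Hypothesis alpha_inj : injective alpha.
Hypothesis alpha_index : (cosets alpha #= `I_N)%card.
Local Notation D := (dual_group R Gamma).
Local Notation astar := (@dual_endo R Gamma alpha).
Variable lambda : probability D R.
Hypothesis lambda_haar : normalized_haar lambda.
Local Notation integ f := (lambda.-integrable [set: D] (EFin \o f)).
Variable s : seq D.
Hypotheses (s_uniq : uniq s) (sP : forall k, k \in s <-> astar k = 1%g).

Let astar_surj : forall chi : D, exists xi, astar xi = chi :=
  dual_endo_surj alpha_index alpha_inj.

Let mastar : measurable_fun [set: D] astar := measurable_dual_endo Gamma_countable alpha.

Let astar_pres A : measurable A -> lambda (astar @^-1` A) = lambda A.
Proof. exact: haar_dual_endo. Qed.

Let mtrans (k : D) : measurable_fun [set: D] (fun xi : D => (k * xi)%g).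
Proof. exact: measurable_translation. Qed.

Let trans_pres (k : D) A : measurable A -> lambda ((fun xi : D => (k * xi)%g) @^-1` A) = lambda A.
Proof. exact: haar_translation. Qed.

Lemma ae_dual_endo (P : D -> Prop) : {ae lambda, forall x, P x} ->
  {ae lambda, forall x, P (astar x)}.
Proof. exact: ae_preserving. Qed.

Lemma ae_kernel_translates (P : D -> Prop) : {ae lambda, forall x, P x} ->
  {ae lambda, forall x, forall k, k \in s -> P (k * x)%g}.
Proof.
move=> aeP; suff H (t : seq D) : {ae lambda, forall x, forall k, k \in t -> P (k * x)%g} by exact: H.
elim: t => [|k t IH]; first exact: aeW.
have := ae_preserving (mtrans k) (trans_pres k) aeP.
move: IH; apply: filterS2 => x h hk k'; rewrite inE => /orP[/eqP->//|]; exact: h.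
Qed.

(** For a character at g, the sum over the kernel is zero unless g = alpha(b), and is then [size s]
    times the character at b evaluated at alpha^*(xi). The induction principle carries measurable
    factorization through alpha^* from characters to indicators. *)
Lemma average_descends (A : set D) : measurable A ->
  exists2 g : D -> R, measurable_fun [set: D] g &
    forall xi, \sum_(k <- s) \1_A (k * xi)%g = g (astar xi).
Proof.
have char_case g : (exists2 b, g = alpha b & forall k, k \in s -> dual_eval k g = 1) \/
    exists2 k, k \in s & dual_eval k g != 1.
  have [[b _ <-]|/(annihilator_separates R alpha_index)[k /sP ks kg]] := pselect (range alpha g).
    by left; exists b => // k /sP k1; rewrite -[LHS]/(astar k b) k1.
  by right; exists k.
have sumE g xi : \sum_(k <- s) dual_eval (k * xi)%g g = (\sum_(k <- s) dual_eval k g) * dual_eval xi g.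
  by rewrite mulr_suml.
move: A; apply: (indicator_induction Gamma_countable (P := fun f => exists2 g : D -> R,
  measurable_fun [set: D] g & forall xi, \sum_(k <- s) f (k * xi)%g = g (astar xi))).
- move=> g; have [[b gb kg]|[k ks kg]] := char_case g.
    exists (fun chi => (size s)%:R * re_char b chi).
      by apply: measurable_funM => //; exact: measurable_re_char.
    move=> xi; rewrite (eq_big_seq (fun=> re_char b (astar xi))).
      by rewrite big_const_seq count_predT iter_addr_0 mulr_natl.
    by move=> k ks; rewrite /re_char -[dual_eval _ g]/(dual_eval k g * dual_eval xi g) kg// mul1r gb.
  exists (fun=> 0) => // xi.
  rewrite -(raddf_sum (@complex.Re R))/= sumE.
  by rewrite (sum_kernel_eq0 s_uniq sP ks kg) mul0r.
- move=> g; have [[b gb kg]|[k ks kg]] := char_case g.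
    exists (fun chi => (size s)%:R * im_char b chi).
      by apply: measurable_funM => //; exact: measurable_im_char.
    move=> xi; rewrite (eq_big_seq (fun=> im_char b (astar xi))).
      by rewrite big_const_seq count_predT iter_addr_0 mulr_natl.
    by move=> k ks; rewrite /im_char -[dual_eval _ g]/(dual_eval k g * dual_eval xi g) kg// mul1r gb.
  exists (fun=> 0) => // xi.
  rewrite -(raddf_sum (@complex.Im R))/= sumE.
  by rewrite (sum_kernel_eq0 s_uniq sP ks kg) mul0r.
- move=> a f h [g mg fg] [g' mg' hg']; exists (fun chi => a * g chi + g' chi).
    by apply: measurable_funD => //; apply: measurable_funM.
  by move=> xi; rewrite big_split -mulr_sumr fg hg'.
- move=> v f Pv _ vf.
  have /choice[g gP] : forall n, exists g, measurable_fun [set: D] g /\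
      forall xi, \sum_(k <- s) v n (k * xi)%g = g (astar xi).
    by move=> n; have [g] := Pv n; exists g.
  have gf xi : g n (astar xi) @[n --> \oo] --> \sum_(k <- s) f (k * xi)%g.
    under eq_fun do rewrite -(gP _).2.
    by apply: cvg_big => [|k _]; [exact: add_continuous|exact: vf].
  (* The sequence [g n] converges at every chi, because every chi is some alpha^*(xi). *)
  exists (fun chi => lim (g n chi @[n --> \oo])).
    apply: (@measurable_fun_cvg _ _ _ _ g) => [n|chi _]; first exact: (gP n).1.
    have [xi <-] := astar_surj chi; rewrite (cvg_lim _ (gf xi))//; exact: gf.
  by move=> xi; rewrite (cvg_lim _ (gf xi)).
Qed.

(** Instead of the image of the exceptional set Z, take the set where the descended kernel sum of
    its indicator is positive. It is measurable and contains every bad chi; its preimage is the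
    union of the kernel translates of Z, which is null. *)
Lemma ae_descends (P : D -> Prop) : {ae lambda, forall xi, P (astar xi)} ->
  {ae lambda, forall chi, P chi}.
Proof.
move=> [Z [mZ Z0 PZ]]; have [g mg gE] := average_descends mZ.
exists (g @^-1` `]0, +oo[); have mB : measurable (g @^-1` `]0, +oo[).
  by rewrite -[X in measurable X]setTI; exact: mg.
split => //.
- rewrite -astar_pres//.
  have : {ae lambda, forall x, ~ Z x} by exists Z; split => // x /= /contrapT.
  move=> /ae_kernel_translates[B [mB' B0 sB]].
  apply/eqP; rewrite -measure_le0 -B0 le_measure ?inE//.
    by rewrite -[X in measurable X]setTI; exact: mastar.
  move=> xi /= gxi; apply: sB => /= h.
  move: gxi; rewrite in_itv/= andbT -gE big_seq big1 ?ltxx// => k ks.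
  by rewrite indicE memNset//; exact: h.
- move=> chi nP; have [xi xiE] := astar_surj chi.
  rewrite /= in_itv/= andbT -xiE -gE.
  rewrite (bigD1_seq 1%g) ?(kernel1 sP)//= mul1g indicE mem_set; last first.
    by apply: PZ => /=; rewrite xiE.
  by rewrite ltr_pwDl// sumr_ge0.
Qed.

(** The difference [u] of the two sides is invariant under the kernel, so its coefficients off
    alpha(Gamma) vanish by [annihilator_separates] and [char_integral_eq0]. Those at alpha(b) vanish
    by hypothesis, since alpha^* and translations preserve Haar measure. Fourier uniqueness
    concludes. *)
Lemma transfer_real F h : integ F -> integ h ->
  (forall b, \int[lambda]_x (re_char b x * F x) = \int[lambda]_x (re_char (alpha b) x * h x)) ->
  (forall b, \int[lambda]_x (im_char b x * F x) = \int[lambda]_x (im_char (alpha b) x * h x)) ->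
  {ae lambda, forall xi, (size s)%:R * F (astar xi) = \sum_(k <- s) h (k * xi)%g}.
Proof.
move=> Fi hi reE imE.
pose u xi := (size s)%:R * F (astar xi) + -1 * \sum_(k <- s) h (k * xi)%g.
have Fai : integ (F \o astar) by exact: integrable_preserving.
have hki k : integ (fun xi => h (k * xi)%g).
  exact: (integrable_preserving (mtrans k) (trans_pres k)).
have hsi : integ (fun xi => \sum_(k <- s) h (k * xi)%g).
  by apply: integrable_bigsum => k _; exact: hki.
have izl c f : integ f -> integ (fun x => c * f x).
  by move=> fi; apply: (@integrable_bounded_mul _ _ _ _ (fun=> c) f `|c|).
have ui : integ u by apply: integrable_lin => //; exact: izl.
suff : {ae lambda, forall x, u x = 0}.
  apply: filterS => xi; rewrite /u mulN1r => /eqP; rewrite subr_eq0 => /eqP//.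
have key (e e' : D -> R) : measurable_fun [set: D] e -> (forall x, `|e x| <= 1) ->
    (forall x, e' x = e (astar x)) ->
    \int[lambda]_x (e x * F x) = \int[lambda]_x (e' x * h x) ->
    \int[lambda]_x (e' x * u x) = 0.
  move=> me e1 e'E eF.
  have eFi : integ (fun x => e x * F x) by exact: integrable_bounded_mul e1 Fi.
  have me' : measurable_fun [set: D] e'.
    by rewrite (_ : e' = e \o astar); [exact: measurableT_comp|exact/funext].
  have e'1 x : `|e' x| <= 1 by rewrite e'E.
  have e'hi : integ (fun x => e' x * h x) by exact: integrable_bounded_mul e'1 hi.
  have e'hki k : integ (fun x => e' x * h (k * x)%g) by exact: integrable_bounded_mul e'1 (hki k).
  transitivity (\int[lambda]_x ((size s)%:R * (e (astar x) * F (astar x)) +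
      -1 * \sum_(k <- s) e' x * h (k * x)%g)).
    apply: eq_Rintegral => x _; rewrite -e'E -mulr_sumr /u; ring.
  have eFai : integ (fun x => e (astar x) * F (astar x)).
    exact: (integrable_preserving mastar astar_pres eFi).
  have sumi : integ (fun x => \sum_(k <- s) e' x * h (k * x)%g).
    by apply: integrable_bigsum => k _; exact: e'hki.
  rewrite Rintegral_lin//; last exact: izl.
  rewrite RintegralZl// (Rintegral_preserving mastar astar_pres eFi) eF.
  rewrite Rintegral_bigsum//.
  rewrite (eq_big_seq (fun=> \int[lambda]_x (e' x * h x))).
    by rewrite big_const_seq count_predT iter_addr_0 mulr_natl mulN1r subrr.
  move=> k ks; rewrite -(Rintegral_preserving (mtrans k) (trans_pres k) e'hi).
  by apply: eq_Rintegral => x _; rewrite !e'E (dual_endo_kernel sP).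
have u_inv k xi : k \in s -> u (k * xi)%g = u xi.
  move=> ks; rewrite /u (dual_endo_kernel sP)//; congr (_ + _ * _).
  rewrite -(kernel_shift s_uniq sP (fun k' => h (k' * xi)%g) ks).
  by apply: eq_bigr => k' _; rewrite mulgA.
have char_int g : \int[lambda]_x (re_char g x * u x) = 0 /\ \int[lambda]_x (im_char g x * u x) = 0.
  have [[b _ <-]|/(annihilator_separates R alpha_index)[k /sP ks kg]] := pselect (range alpha g).
    split.
      by apply: (key (re_char b)) => //; [exact: measurable_re_char|move=> x; exact: normr_re_char].
    by apply: (key (im_char b)) => //; [exact: measurable_im_char|move=> x; exact: normr_im_char].
  by apply: (char_integral_eq0 Gamma_countable lambda_haar ui _ kg) => xi; exact: u_inv.
by apply: (fourier_uniqueness Gamma_countable ui) => g; have [] := char_int g.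
Qed.

End Transfer.

(** * Complex-valued integrands and their Fourier coefficients *)

Section ComplexIntegrals.
Variables (R : realType) (Gamma : zmodType).
Local Open Scope complex_scope.
Local Notation D := (dual_group R Gamma).
Local Notation finmeas := {finite_measure set D -> \bar R}.
Implicit Types F G : D -> R[i].

Lemma ReM (z w : R[i]) : complex.Re (z * w) =
  complex.Re z * complex.Re w - complex.Im z * complex.Im w.
Proof. by case: z; case: w. Qed.

Lemma ImM (z w : R[i]) : complex.Im (z * w) =
  complex.Re z * complex.Im w + complex.Im z * complex.Re w.
Proof. by case: z => a b; case: w => c d /=. Qed.

Lemma Re_conj (z : R[i]) : complex.Re (Num.conj z) = complex.Re z.
Proof. by case: z. Qed.

Lemma Im_conj (z : R[i]) : complex.Im (Num.conj z) = - complex.Im z.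
Proof. by case: z. Qed.

Lemma normcE (z : R[i]) : Normc.normc z ^+ 2 = complex.Re z ^+ 2 + complex.Im z ^+ 2.
Proof. by case: z => a b /=; rewrite sqr_sqrtr// addr_ge0// sqr_ge0. Qed.

Lemma mulr_conjC (z : R[i]) : z * Num.conj z = (Normc.normc z ^+ 2)%:C.
Proof.
apply/eqP; rewrite eq_complex ReM ImM Re_conj Im_conj normcE/=.
by apply/andP; split; apply/eqP; ring.
Qed.

Lemma normC_sqr (z : R[i]) : `|z| ^+ 2 = (Normc.normc z ^+ 2)%:C.
Proof. by rewrite normCK mulr_conjC. Qed.

Lemma cmeasurableM F G : cmeasurable F -> cmeasurable G ->
  cmeasurable (fun chi => F chi * G chi).
Proof.
move=> [F1 F2] [G1 G2]; split.
  by under eq_fun do rewrite ReM; apply: measurable_funB; exact: measurable_funM.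
by under eq_fun do rewrite ImM; apply: measurable_funD; exact: measurable_funM.
Qed.

Lemma cmeasurable_conj F : cmeasurable F -> cmeasurable (fun chi => Num.conj (F chi)).
Proof.
move=> [F1 F2]; split; first by under eq_fun do rewrite Re_conj.
by under eq_fun do rewrite Im_conj; exact: measurable_funN.
Qed.

Lemma cmeasurable_real (f : D -> R) : measurable_fun [set: D] f ->
  cmeasurable (fun chi => (f chi)%:C).
Proof. by move=> mf; split. Qed.

Lemma cintegral_ae_eq (mu : finmeas) F G : cmeasurable F -> cmeasurable G ->
  {ae mu, forall chi, F chi = G chi} -> cintegral mu F = cintegral mu G.
Proof.
move=> [F1 F2] [G1 G2] FG; congr (_ +i* _); congr fine; apply: ae_eq_integral => //;
  try exact/measurable_EFinP; by apply: filterS FG => chi + _ => /= ->.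
Qed.

Lemma cvg_Re (z : nat -> R[i]^o) (l : R[i]^o) : z n @[n --> \oo] --> l ->
  complex.Re (z n) @[n --> \oo] --> (complex.Re l : R).
Proof.
move=> /cvgrPdist_lt zl; apply/cvgrPdist_lt => e e0.
have := zl e%:C; rewrite ltcR => /(_ e0); apply: filterS => n /normC_ltP[+ _].
by rewrite raddfB.
Qed.

Lemma cvg_Im (z : nat -> R[i]^o) (l : R[i]^o) : z n @[n --> \oo] --> l ->
  complex.Im (z n) @[n --> \oo] --> (complex.Im l : R).
Proof.
move=> /cvgrPdist_lt zl; apply/cvgrPdist_lt => e e0.
have := zl e%:C; rewrite ltcR => /(_ e0); apply: filterS => n /normC_ltP[_].
by rewrite raddfB.
Qed.

End ComplexIntegrals.

Section ComplexFourier.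
Variables (R : realType) (Gamma : zmodType).
Hypothesis Gamma_countable : countable [set: Gamma].
Local Open Scope complex_scope.
Local Notation D := (dual_group R Gamma).
Variable lambda : probability D R.
Implicit Types F G : D -> R[i].

Definition cintegrable F : Prop :=
  lambda.-integrable [set: D] (EFin \o (fun chi => complex.Re (F chi))) /\
  lambda.-integrable [set: D] (EFin \o (fun chi => complex.Im (F chi))).

Lemma cmeasurable_char g : cmeasurable (fun chi : D => chi g).
Proof. by split; [exact: measurable_re_char|exact: measurable_im_char]. Qed.

Lemma cintegrable_conj F : cintegrable F -> cintegrable (fun chi => Num.conj (F chi)).
Proof.
move=> [F1 F2]; split.
  by under [X in EFin \o X]eq_fun do rewrite Re_conj.
under [X in EFin \o X]eq_fun do rewrite Im_conj.
by have := integrableN F2; apply: eq_integrable.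
Qed.

Lemma cintegral_conj F : cintegrable F ->
  cintegral lambda (fun chi => Num.conj (F chi)) = Num.conj (cintegral lambda F).
Proof.
move=> [F1 F2]; rewrite /cintegral; apply/eqP; rewrite eq_complex Re_conj Im_conj/=.
apply/andP; split; apply/eqP.
  by apply: eq_Rintegral => x _; rewrite Re_conj.
rewrite -mulN1r -RintegralZl//; apply: eq_Rintegral => x _.
by rewrite Im_conj mulN1r.
Qed.

Lemma integrable_re_char g f : lambda.-integrable [set: D] (EFin \o f) ->
  lambda.-integrable [set: D] (EFin \o (fun x => re_char g x * f x)).
Proof.
by apply: integrable_bounded_mul (@normr_re_char _ _ _); exact: measurable_re_char.
Qed.

Lemma integrable_im_char g f : lambda.-integrable [set: D] (EFin \o f) ->
  lambda.-integrable [set: D] (EFin \o (fun x => im_char g x * f x)).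
Proof.
by apply: integrable_bounded_mul (@normr_im_char _ _ _); exact: measurable_im_char.
Qed.

Lemma cintegral_char F g : cintegrable F ->
  cintegral lambda (fun chi => chi g * F chi) =
  (\int[lambda]_x (re_char g x * complex.Re (F x)) -
   \int[lambda]_x (im_char g x * complex.Im (F x))) +i*
  (\int[lambda]_x (re_char g x * complex.Im (F x)) +
   \int[lambda]_x (im_char g x * complex.Re (F x))).
Proof.
move=> [F1 F2]; rewrite /cintegral.
congr (_ +i* _).
  rewrite -RintegralB//; [|exact: integrable_re_char|exact: integrable_im_char].
  by apply: eq_Rintegral => x _; rewrite ReM.
rewrite -RintegralD//; [|exact: integrable_re_char|exact: integrable_im_char].
by apply: eq_Rintegral => x _; rewrite ImM.
Qed.

Lemma cintegrable_char F g : cintegrable F -> cintegrable (fun chi => chi g * F chi).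
Proof.
move=> [F1 F2].
split.
  under [X in EFin \o X]eq_fun do rewrite ReM.
  have := integrableB measurableT (integrable_re_char g F1) (integrable_im_char g F2).
  exact: eq_integrable.
under [X in EFin \o X]eq_fun do rewrite ImM.
have := integrableD measurableT (integrable_re_char g F2) (integrable_im_char g F1).
exact: eq_integrable.
Qed.

Variables (alpha : {additive Gamma -> Gamma}) (N : nat).
Hypothesis alpha_inj : injective alpha.
Hypothesis alpha_index : (cosets alpha #= `I_N)%card.
Local Notation astar := (@dual_endo R Gamma alpha).
Hypothesis lambda_haar : normalized_haar lambda.
Variable s : seq D.
Hypotheses (s_uniq : uniq s) (sP : forall k, k \in s <-> astar k = 1%g).

Lemma transfer F G : cintegrable F -> cintegrable G ->
  (forall b, cintegral lambda (fun chi => chi b * F chi) =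
             cintegral lambda (fun xi => xi (alpha b) * G xi)) ->
  {ae lambda, forall xi, (size s)%:R * F (astar xi) = \sum_(k <- s) G (k * xi)%g}.
Proof.
move=> Fi Gi FG; have [F1 F2] := Fi; have [G1 G2] := Gi.
have imN g f : lambda.-integrable [set: D] (EFin \o f) ->
    \int[lambda]_x (im_char (- g) x * f x) = - \int[lambda]_x (im_char g x * f x).
  move=> fi; rewrite -mulN1r -RintegralZl//.
    by apply: eq_Rintegral => x _; rewrite im_charN mulN1r mulNr.
  exact: integrable_im_char.
have reN g f : \int[lambda]_x (re_char (- g) x * f x) = \int[lambda]_x (re_char g x * f x).
  by apply: eq_Rintegral => x _; rewrite re_charN.
have E b : [/\ \int[lambda]_x (re_char b x * complex.Re (F x)) =
      \int[lambda]_x (re_char (alpha b) x * complex.Re (G x)),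
    \int[lambda]_x (im_char b x * complex.Re (F x)) =
      \int[lambda]_x (im_char (alpha b) x * complex.Re (G x)),
    \int[lambda]_x (re_char b x * complex.Im (F x)) =
      \int[lambda]_x (re_char (alpha b) x * complex.Im (G x)) &
    \int[lambda]_x (im_char b x * complex.Im (F x)) =
      \int[lambda]_x (im_char (alpha b) x * complex.Im (G x))].
  (* The equation at b mixes the four real integrals in pairs; passing to -b changes the sign of
     those with [im_char], so the two equations together separate all four. *)
  have := FG b; have := FG (- b).
  rewrite !cintegral_char// raddfN !reN !imN// => -[e1 e2] [e3 e4].
  by split; lra.
have h1 := transfer_real Gamma_countable alpha_inj alpha_index lambda_haar s_uniq sP F1 G1
  (fun b => let: And4 e _ _ _ := E b in e) (fun b => let: And4 _ e _ _ := E b in e).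
have h2 := transfer_real Gamma_countable alpha_inj alpha_index lambda_haar s_uniq sP F2 G2
  (fun b => let: And4 _ _ e _ := E b in e) (fun b => let: And4 _ _ _ e := E b in e).
have nE : (size s)%:R = ((size s)%:R : R)%:C by rewrite rmorph_nat.
rewrite nE; move: (size s)%:R h1 h2 => c; apply: filterS2 => xi e1 e2.
apply/eqP; rewrite eq_complex (raddf_sum (@complex.Re R)) (raddf_sum (@complex.Im R)).
by rewrite ReM ImM /= !mul0r subr0 addr0 e1 e2 !eqxx.
Qed.

End ComplexFourier.

(** * Spectral models *)

Section SpectralRepresentation.
Variables (R : realType) (Gamma : zmodType).
Hypothesis Gamma_countable : countable [set: Gamma].
Local Open Scope complex_scope.
Local Notation D := (dual_group R Gamma).
Local Notation finmeas := {finite_measure set D -> \bar R}.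
Variable lambda : probability D R.
Variables (K : hilbertType R) (rho : unitary_rep Gamma K).
Variables (mu : finmeas) (sigma : nat -> set D) (T : K -> nat -> D -> R[i]).
Hypothesis SD : spectral_data rho mu sigma T.
Hypothesis mu_lambda : forall E, measurable E -> mu E = lambda (E `&` sigma 0%N).

Let msigma i : measurable (sigma i).
Proof. by case: SD => -[]. Qed.

Let sigma_le i : sigma i `<=` sigma 0%N.
Proof.
case: SD => -[_ h _] _ _ _; elim: i => [//|i IH]; exact: subset_trans (h i) IH.
Qed.

(** [mu] is blind off [sigma 0]; identities between coordinates hold there because both sides
    vanish. *)
Lemma ae_spectral (P : D -> Prop) : {ae mu, forall x, P x} ->
  (forall x, ~ sigma 0%N x -> P x) -> {ae lambda, forall x, P x}.
Proof.
move=> [Z [mZ Z0 PZ]] nP; exists (Z `&` sigma 0%N); split.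
- exact: measurableI.
- by rewrite -mu_lambda.
- move=> x nPx; split; first exact: PZ.
  by apply: contrapT => /nP.
Qed.

Lemma integral_spectral (f : D -> \bar R) : (forall x, ~ sigma 0%N x -> f x = 0%E) ->
  (\int[mu]_x f x = \int[lambda]_x f x)%E.
Proof.
move=> f0; have fE : f = f \_ (sigma 0%N).
  apply/funext => x; rewrite patchE; case: ifPn => // /negP h.
  by apply: f0 => sx; apply: h; exact: mem_set.
rewrite fE -!integral_mkcond; apply: eq_measure_integral => A mA As.
by transitivity (lambda (A `&` sigma 0%N)); [exact: mu_lambda|rewrite setIidl].
Qed.

Lemma cintegral_spectral (F : D -> R[i]) : (forall x, ~ sigma 0%N x -> F x = 0) ->
  cintegral mu F = cintegral lambda F.
Proof.
move=> F0; rewrite /cintegral /Rintegral; congr (fine _ +i* fine _);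
  by apply: integral_spectral => x /F0 ->.
Qed.

Lemma spectral_cmeasurable f i : cmeasurable (T f i).
Proof. by case: SD => _ [/(_ f)[]]. Qed.

Lemma spectral_off f i x : ~ sigma i x -> T f i x = 0.
Proof. by case: SD => _ [/(_ f)[_ + _] _ _ _] _ _; apply. Qed.

Lemma spectral_off0 f i x : ~ sigma 0%N x -> T f i x = 0.
Proof. by move=> nx; apply: spectral_off => /sigma_le. Qed.

(** The bracket of f with itself, as [inner_square] shows. It is extended-real because the series is
    finite only almost everywhere. *)
Definition fiber_sqnorm f x : \bar R := (\sum_(i <oo) (Normc.normc (T f i x) ^+ 2)%:E)%E.

Lemma measurable_normc2 f i : measurable_fun [set: D] (fun x => Normc.normc (T f i x) ^+ 2).
Proof.
have [m1 m2] := spectral_cmeasurable f i.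
under eq_fun do rewrite normcE.
by apply: measurable_funD; exact: measurable_funX.
Qed.

Lemma measurable_fiber_sqnorm f : measurable_fun [set: D] (fiber_sqnorm f).
Proof.
apply: ge0_emeasurable_sum => [i x _ _|i _]; first by rewrite lee_fin sqr_ge0.
by apply/measurable_EFinP; exact: measurable_normc2.
Qed.

Lemma fiber_sqnorm_ge0 f x : (0 <= fiber_sqnorm f x)%E.
Proof. by apply: nneseries_ge0 => i _ _; rewrite lee_fin sqr_ge0. Qed.

Lemma integrable_fiber_sqnorm f : lambda.-integrable [set: D] (fiber_sqnorm f).
Proof.
apply/integrableP; split; first exact: measurable_fiber_sqnorm.
under eq_integral do rewrite gee0_abs ?fiber_sqnorm_ge0//.
rewrite integral_nneseries//; last 2 first.
- by move=> i; apply/measurable_EFinP; exact: measurable_normc2.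
- by move=> i x _; rewrite lee_fin sqr_ge0.
case: SD => _ [/(_ f)[_ _ +] _ _ _] _ _.
under eq_eseriesr => i _.
  rewrite integral_spectral; last first.
    by move=> x nx; rewrite spectral_off0// normcE/= expr0n/= addr0.
  over.
by [].
Qed.

Lemma fiber_sqnorm_fin f : {ae lambda, forall x, fiber_sqnorm f x \is a fin_num}.
Proof.
have := integrable_ae measurableT (integrable_fiber_sqnorm f).
by apply: filterS => x /(_ I).
Qed.

Lemma integrable_fine_sqnorm f :
  lambda.-integrable [set: D] (EFin \o (fun x => fine (fiber_sqnorm f x))).
Proof.
apply/integrableP; split.
  apply/measurable_EFinP; apply: measurableT_comp => //; exact: measurable_fiber_sqnorm.
have /integrableP[_] := integrable_fiber_sqnorm f.
apply: le_lt_trans; apply: ge0_le_integral => //.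
- apply: measurableT_comp => //; apply/measurable_EFinP.
  by apply: measurableT_comp => //; exact: measurable_fiber_sqnorm.
- by apply: measurableT_comp => //; exact: measurable_fiber_sqnorm.
- move=> x _; rewrite (gee0_abs (fiber_sqnorm_ge0 f x)) /=.
  have := fiber_sqnorm_ge0 f x; case: (fiber_sqnorm f x) => [r| |]//= r0.
    by rewrite lee_fin ger0_norm.
  by rewrite normr0 leey.
Qed.

Lemma integrable_normc2 f i :
  lambda.-integrable [set: D] (EFin \o (fun x => Normc.normc (T f i x) ^+ 2)).
Proof.
have mT : measurable_fun [set: D] (EFin \o (fun x => Normc.normc (T f i x) ^+ 2)).
  by apply/measurable_EFinP; exact: measurable_normc2.
apply: (le_integrable measurableT mT _ (integrable_fiber_sqnorm f)) => x _.
rewrite /= ger0_norm ?sqr_ge0// gee0_abs ?fiber_sqnorm_ge0//.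
rewrite /fiber_sqnorm (@nneseriesD1 _ _ i)//; last by move=> j _; rewrite lee_fin sqr_ge0.
by rewrite leeDl// nneseries_ge0// => j _ _; rewrite lee_fin sqr_ge0.
Qed.

(** Square-integrable implies integrable on a probability space, through |y| <= 1 + y^2 + z^2. *)
Lemma spectral_cintegrable f i : cintegrable lambda (T f i).
Proof.
have [m1 m2] := spectral_cmeasurable f i.
have ni : lambda.-integrable [set: D] (EFin \o (fun x => 1 * 1 + Normc.normc (T f i x) ^+ 2)).
  by apply: integrable_lin; [exact: integrable_constant|exact: integrable_normc2].
have bnd (y z : R) : `|y| <= `|1 * 1 + (y ^+ 2 + z ^+ 2)|.
  have y2 : 0 <= y ^+ 2 by exact: sqr_ge0.
  have z2 : 0 <= z ^+ 2 by exact: sqr_ge0.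
  rewrite mulr1 [leRHS]ger0_norm ?addr_ge0// -(real_normK (num_real y)).
  by have := sqr_ge0 (`|y| - 1); rewrite sqrrB1; have := normr_ge0 y; lra.
split; apply: (le_integrable measurableT _ _ ni); try exact/measurable_EFinP;
  move=> x _; rewrite /= lee_fin normcE; first exact: bnd.
by rewrite [X in 1 * 1 + X]addrC; exact: bnd.
Qed.

Lemma cintegral_char_real (f : D -> R) a :
  cintegral lambda (fun chi => chi a * (f chi)%:C) =
  (\int[lambda]_x (re_char a x * f x)) +i* (\int[lambda]_x (im_char a x * f x)).
Proof.
rewrite /cintegral; congr (_ +i* _); apply: eq_Rintegral => x _.
  by rewrite ReM /= mulr0 subr0.
by rewrite ImM /= mulr0 add0r.
Qed.

Lemma cmeasurable_mul_conj f g i : cmeasurable (fun x => T f i x * Num.conj (T g i x)).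
Proof. by apply: cmeasurableM; [|apply: cmeasurable_conj]; exact: spectral_cmeasurable. Qed.

Lemma spectral_inner f g a :
  (fun n => \sum_(i < n) cintegral lambda
     (fun chi => chi a * (T f i chi * Num.conj (T g i chi))) : R[i]^o)
    @ \oo --> ('[rho a f, g] : R[i]^o).
Proof.
case: SD => _ [_ _ /(_ (rho a f) g) h _] Trho _.
apply: cvg_trans h; apply: near_eq_cvg; apply: nearW => n; apply: eq_bigr => i _.
rewrite -[RHS]cintegral_spectral; last by move=> x nx; rewrite !spectral_off0// mul0r mulr0.
apply: cintegral_ae_eq; first exact: cmeasurable_mul_conj.
  by apply: cmeasurableM; [exact: cmeasurable_char|exact: cmeasurable_mul_conj].
by apply: filterS (Trho a f i) => x ->; rewrite mulrA.
Qed.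

(** The coordinate [T f i] is thus the bracket of f with the i-th generator. The partial sums in
    [spectral_inner] are constant beyond i, and the indicator disappears because [T f i] vanishes
    off [sigma i]. *)
Lemma inner_generator f e i a :
  (forall j, {ae mu, forall x, T e j x = if j == i then (\1_(sigma i) x)%:C else 0}) ->
  '[rho a f, e] = cintegral lambda (fun chi => chi a * T f i chi).
Proof.
move=> eE.
have h n : \sum_(j < n) cintegral lambda (fun chi => chi a * (T f j chi * Num.conj (T e j chi))) =
    if (i < n)%N then cintegral lambda (fun chi => chi a * T f i chi) else 0.
  transitivity (\sum_(j < n) if nat_of_ord j == i
      then cintegral lambda (fun chi => chi a * T f i chi) else 0).
    apply: eq_bigr => j _; rewrite -cintegral_spectral; last first.
      by move=> x nx; rewrite !spectral_off0// mul0r mulr0.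
    case: eqP => [->|/eqP ji].
      rewrite -cintegral_spectral; last first.
        by move=> x nx; rewrite spectral_off0// mulr0.
      apply: cintegral_ae_eq.
      + by apply: cmeasurableM; [exact: cmeasurable_char|exact: cmeasurable_mul_conj].
      + by apply: cmeasurableM; [exact: cmeasurable_char|exact: spectral_cmeasurable].
      + apply: filterS (eE i) => x ->; rewrite eqxx indicE; case: (boolP (x \in sigma i)) => [_|xi].
          by rewrite rmorph1 mulr1.
        by rewrite spectral_off ?mul0r// => /mem_set; exact/negP.
    rewrite -[RHS](_ : cintegral mu (fun=> 0) = 0); last first.
      by rewrite /cintegral /Rintegral/= !integral0.
    apply: cintegral_ae_eq.
    + by apply: cmeasurableM; [exact: cmeasurable_char|exact: cmeasurable_mul_conj].
    + by split; exact: measurable_cst.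
    + by apply: filterS (eE j) => x ->; rewrite (negbTE ji) rmorph0 !mulr0.
  rewrite -big_mkcond/=; case: ltnP => [ni|ni].
    by rewrite (big_pred1 (Ordinal ni))// => j; rewrite -val_eqE.
  rewrite big_pred0// => j; apply/negbTE; rewrite neq_ltn.
  by rewrite (leq_trans (ltn_ord j) ni).
have h1 := @spectral_inner f e a.
apply: (cvg_unique _ h1); first exact: norm_hausdorff.
apply: cvg_near_cst; exists i.+1 => // n /= ni.
by rewrite h ni.
Qed.

Lemma inner_square f a : '[rho a f, f] =
  cintegral lambda (fun chi => chi a * (fine (fiber_sqnorm f chi))%:C).
Proof.
have h := @spectral_inner f f a.
pose S n x := \sum_(i < n) Normc.normc (T f i x) ^+ 2.
(* Dominated convergence with [fiber_sqnorm f] itself as the bound; [c] will be the real and then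
   the imaginary part of a character. *)
have key (c : D -> R) : measurable_fun [set: D] c -> (forall x, `|c x| <= 1) ->
   (fun n => \sum_(i < n) \int[lambda]_x (c x * Normc.normc (T f i x) ^+ 2)) @ \oo -->
   \int[lambda]_x (c x * fine (fiber_sqnorm f x)).
  move=> mc c1.
  have mS n : measurable_fun [set: D] (S n).
    by apply: measurable_sum => i; exact: measurable_normc2.
  apply: cvg_trans (@Rintegral_dominated_cvg _ _ _ lambda
    (fun n x => c x * S n x) (fun x => c x * fine (fiber_sqnorm f x))
    (fun x => fine (fiber_sqnorm f x)) _ _ _ (integrable_fine_sqnorm f) _).
  - apply: near_eq_cvg; apply: nearW => n.
    rewrite -Rintegral_bigsum; last first.
      by move=> i _; apply: integrable_bounded_mul c1 (integrable_normc2 f i).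
    by apply: eq_Rintegral => x _; rewrite mulr_sumr.
  - by move=> n; apply: measurable_funM.
  - by apply: measurable_funM => //; apply: measurableT_comp => //; exact: measurable_fiber_sqnorm.
  - apply: filterS (fiber_sqnorm_fin f) => x fx.
    apply: cvgM; first exact: cvg_cst.
    have /fine_cvg : (fun n => (S n x)%:E) @ \oo --> (fine (fiber_sqnorm f x))%:E.
      rewrite fineK//.
      have := @is_cvg_nneseries R (fun i => (Normc.normc (T f i x) ^+ 2)%:E) xpredT 0%N
        (fun i _ _ => eq_ind_r is_true (sqr_ge0 _) (lee_fin _ _)).
      move=> hc; apply: cvg_trans (hc : _ --> fiber_sqnorm f x).
      by apply: near_eq_cvg; apply: nearW => n; rewrite big_mkord sumEFin.
    by [].
  - apply: filterS (fiber_sqnorm_fin f) => x fx n.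
    have S0 : 0 <= S n x by apply: sumr_ge0 => i _; exact: sqr_ge0.
    rewrite normrM (ger0_norm S0); apply: le_trans (ler_piMl S0 (c1 x)) _.
    rewrite -lee_fin fineK// /S -sumEFin -(big_mkord xpredT (fun i => (Normc.normc (T f i x) ^+ 2)%:E)).
    by apply: nneseries_lim_ge => i _ _; rewrite lee_fin sqr_ge0.
have E n : \sum_(i < n) cintegral lambda (fun chi => chi a * (T f i chi * Num.conj (T f i chi))) =
    (\sum_(i < n) \int[lambda]_x (re_char a x * Normc.normc (T f i x) ^+ 2)) +i*
    (\sum_(i < n) \int[lambda]_x (im_char a x * Normc.normc (T f i x) ^+ 2)).
  have e i : cintegral lambda (fun chi => chi a * (T f i chi * Num.conj (T f i chi))) =
      (\int[lambda]_x (re_char a x * Normc.normc (T f i x) ^+ 2)) +i*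
      (\int[lambda]_x (im_char a x * Normc.normc (T f i x) ^+ 2)).
    by rewrite -cintegral_char_real; congr (cintegral _ _); apply/funext => x; rewrite mulr_conjC.
  under eq_bigr do rewrite e.
  by apply/eqP; rewrite eq_complex (raddf_sum (@complex.Re R)) (raddf_sum (@complex.Im R)) /= !eqxx.
have hre := cvg_Re h; have him := cvg_Im h.
move: hre him; under eq_fun do rewrite E/=; move=> hre.
under eq_fun do rewrite E/=; move=> him.
rewrite cintegral_char_real; apply/eqP; rewrite eq_complex /=; apply/andP; split; apply/eqP.
  apply: cvg_unique hre (key _ _ _) => //; first exact: measurable_re_char.
  by move=> x; exact: normr_re_char.
apply: cvg_unique him (key _ _ _) => //; first exact: measurable_im_char.
by move=> x; exact: normr_im_char.
Qed.

(** Surjectivity of the model applied to the indicator of [sigma i] in the i-th place,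
    square-integrable because [mu] is finite. *)
Lemma exists_generator i : exists e, forall j,
  {ae mu, forall x, T e j x = if j == i then (\1_(sigma i) x)%:C else 0}.
Proof.
case: SD => _ [_ _ _ +] _ _.
move=> /(_ (fun j x => if j == i then (\1_(sigma i) x)%:C else 0)); apply; split.
- move=> j; case: eqP => _; last by split; exact: measurable_cst.
  by apply: cmeasurable_real; exact: measurable_indic.
- by move=> j x; case: eqP => // -> nx; rewrite indicE memNset// rmorph0.
- rewrite (@nneseriesD1 _ _ i)//; last by move=> j _; apply: integral_ge0 => x _; rewrite lee_fin sqr_ge0.
  rewrite [X in (_ + X)%E]eseries0 ?adde0; last first.
    by move=> j _ /= ji; rewrite (negbTE ji); apply: integral0_eq => x _; rewrite normcE/= expr0n/= addr0.
  rewrite eqxx; apply: (@le_lt_trans _ _ (\int[mu]_x (cst 1 x))%E); last first.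
    by rewrite integral_cst// mul1e ltey_eq fin_num_measure.
  apply: ge0_le_integral => //.
  + by move=> x _; rewrite lee_fin sqr_ge0.
  + apply/measurable_EFinP; under eq_fun do rewrite normcE.
    by apply: measurable_funD; apply: measurable_funX => //; exact: measurable_indic.
  + move=> x _; rewrite lee_fin normcE/= expr0n/= addr0 indicE.
    by case: (x \in _); rewrite ?expr1n ?expr0n.
Qed.

End SpectralRepresentation.

(** * Comparison of two spectral models along a unitary that intertwines through alpha *)

Section MultiplicityTransfer.
Variables (R : realType) (Gamma : zmodType).
Hypothesis Gamma_countable : countable [set: Gamma].
Local Open Scope complex_scope.
Local Notation D := (dual_group R Gamma).
Local Notation finmeas := {finite_measure set D -> \bar R}.
Variables (alpha : {additive Gamma -> Gamma}) (N : nat).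
Hypothesis alpha_inj : injective alpha.
Hypothesis N_gt0 : (0 < N)%N.
Hypothesis alpha_index : (cosets alpha #= `I_N)%card.
Local Notation astar := (@dual_endo R Gamma alpha).
Variable lambda : probability D R.
Hypothesis lambda_haar : normalized_haar lambda.

Variables (K1 K2 : hilbertType R).
Variables (rho1 : unitary_rep Gamma K1) (rho2 : unitary_rep Gamma K2).
Variables (U : K1 -> K2).
Hypothesis U_inner : forall x y, '[U x, U y] = '[x, y].
Hypothesis U_surj : forall y, exists x, U x = y.
Hypothesis U_rho : forall a x, rho2 a (U x) = U (rho1 (alpha a) x).

Variables (mu1 : finmeas) (sigma1 : nat -> set D) (T1 : K1 -> nat -> D -> R[i]).
Hypothesis SD1 : spectral_data rho1 mu1 sigma1 T1.
Hypothesis mu1_lambda : forall E, measurable E -> mu1 E = lambda (E `&` sigma1 0%N).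
Variables (mu2 : finmeas) (sigma2 : nat -> set D) (T2 : K2 -> nat -> D -> R[i]).
Hypothesis SD2 : spectral_data rho2 mu2 sigma2 T2.
Hypothesis mu2_lambda : forall E, measurable E -> mu2 E = lambda (E `&` sigma2 0%N).

Lemma inner_repN (K : hilbertType R) (rho : unitary_rep Gamma K) a x y :
  '[rho a x, y] = Num.conj '[rho (- a) y, x].
Proof.
rewrite -[LHS](unitary_inner (rho (- a))) -repD addNr rep0.
have := @hermitian_subproof _ _ _ _ (inner : {dot K for (@Num.conj R[i])}) x (rho (- a) y).
by rewrite expr0 mul1r.
Qed.

Lemma inner_generator_r f e i a :
  (forall j, {ae mu1, forall x, T1 e j x = if j == i then (\1_(sigma1 i) x)%:C else 0}) ->
  '[rho1 a e, f] = cintegral lambda (fun chi => chi a * Num.conj (T1 f i chi)).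
Proof.
move=> eE; rewrite inner_repN (inner_generator SD1 mu1_lambda _ _ eE)//.
rewrite -cintegral_conj; last first.
  by apply: cintegrable_char => //; exact: (spectral_cintegrable SD1 mu1_lambda).
congr cintegral; apply/funext => x.
by rewrite rmorphM/= dual_evalN conjCK.
Qed.

Lemma generator_diag K (rho : unitary_rep Gamma K) mu sigma T e i :
  spectral_data rho mu sigma T ->
  (forall E, measurable E -> mu E = lambda (E `&` sigma 0%N)) ->
  {ae mu, forall x, T e i x = (\1_(sigma i) x)%:C} ->
  {ae lambda, forall x, T e i x = (\1_(sigma i) x)%:C}.
Proof.
move=> SD mulam h; apply: (ae_spectral SD mulam h) => x nx.
rewrite (spectral_off0 SD)// indicE memNset// => sx.
case: SD => -[_ sle _] _ _ _; apply: nx.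
by elim: i sx {h} => // i IH /sle/IH.
Qed.

Section Fibers.
Variable s : seq D.
Hypotheses (s_uniq : uniq s) (sP : forall k, k \in s <-> astar k = 1%g).
Variable r : 'I_N -> Gamma.
Hypothesis r_surj : forall x, exists l y, x = r l + alpha y.
Hypothesis r_inj : forall l l' y, r l = r l' + alpha y -> l = l'.

Let transfer := transfer Gamma_countable alpha_inj alpha_index lambda_haar s_uniq sP.

(** The translate by r_l is unitary and commutes with the representation, so the bracket of the
    image vector with itself has the coefficients of e at alpha(b), whatever l is. The bracket of e
    with itself is its i-th coordinate, an indicator. *)
Lemma generator_sqnorm_transfer e i l :
  (forall j, {ae mu1, forall x, T1 e j x = if j == i then (\1_(sigma1 i) x)%:C else 0}) ->
  {ae lambda, forall xi, ((size s)%:R%:E * fiber_sqnorm T2 (U (rho1 (r l) e)) (astar xi) =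
    (\sum_(k <- s) \1_(sigma1 i) (k * xi)%g)%:E)%E}.
Proof.
move=> eE.
have Fi : cintegrable lambda (fun x => (fine (fiber_sqnorm T2 (U (rho1 (r l) e)) x))%:C).
  by split; [exact: (integrable_fine_sqnorm SD2 mu2_lambda)|exact: integrable_constant].
have Gi := spectral_cintegrable SD1 mu1_lambda e i.
have h1 : {ae lambda, forall xi, (size s)%:R *
    (fine (fiber_sqnorm T2 (U (rho1 (r l) e)) (astar xi)))%:C =
    \sum_(k <- s) T1 e i (k * xi)%g}.
  apply: (transfer Fi Gi) => b.
  rewrite -(inner_square SD2 mu2_lambda).
  rewrite -(inner_generator SD1 mu1_lambda _ _ eE).
  rewrite U_rho U_inner -repD addrC repD; exact: unitary_inner.
have h2 := ae_dual_endo Gamma_countable alpha_inj alpha_index lambda_haar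
  (fiber_sqnorm_fin SD2 mu2_lambda (U (rho1 (r l) e))).
have h3 : {ae lambda, forall x, T1 e i x = (\1_(sigma1 i) x)%:C}.
  by apply: (generator_diag SD1 mu1_lambda); have := eE i; apply: filterS => x; rewrite eqxx.
have {}h3 := ae_kernel_translates Gamma_countable lambda_haar s h3.
move: h1 h2 h3; apply: filterS3 => xi e1 e2 e3.
rewrite -(fineK e2) -EFinM; congr EFin.
move: e1; rewrite (eq_big_seq _ e3) -rmorph_sum -(rmorph_nat (real_complex R)) -rmorphM.
exact: complexI.
Qed.

(** The bracket of e with g is the conjugate of the i-th coordinate of g, and translating e by r_l
    multiplies it by xi(r_l). The transferred identity is linear in the j-th coordinate with factor
    [size s]; squaring it and summing over l with [kernel_plancherel] gives the square of [size s]
    and the factor N. *)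
Lemma coefficient_transfer e e' g i j :
  (forall i', {ae mu1, forall x, T1 e i' x = if i' == i then (\1_(sigma1 i) x)%:C else 0}) ->
  (forall j', {ae mu2, forall x, T2 e' j' x = if j' == j then (\1_(sigma2 j) x)%:C else 0}) ->
  U g = e' ->
  {ae lambda, forall xi, (size s)%:R ^+ 2 *
      \sum_l Normc.normc (T2 (U (rho1 (r l) e)) j (astar xi)) ^+ 2 =
    N%:R * \sum_(k <- s) Normc.normc (T1 g i (k * xi)%g) ^+ 2}.
Proof.
move=> eE e'E gE.
have h l' : {ae lambda, forall xi, (size s)%:R * T2 (U (rho1 (r l') e)) j (astar xi) =
    \sum_(k <- s) dual_eval (k * xi)%g (r l') * Num.conj (T1 g i (k * xi)%g)}.
  have Fi := spectral_cintegrable SD2 mu2_lambda (U (rho1 (r l') e)) j.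
  have Gi : cintegrable lambda (fun x => dual_eval x (r l') * Num.conj (T1 g i x)).
    apply: cintegrable_char => //; apply: cintegrable_conj.
    exact: (spectral_cintegrable SD1 mu1_lambda).
  apply: (transfer Fi Gi) => b.
  rewrite -(inner_generator SD2 mu2_lambda _ _ e'E).
  rewrite -gE U_rho U_inner -repD (inner_generator_r _ _ eE).
  by congr cintegral; apply/funext => x; rewrite dual_evalD mulrA.
have {}h : {ae lambda, forall xi, forall l', (size s)%:R * T2 (U (rho1 (r l') e)) j (astar xi) =
    \sum_(k <- s) dual_eval (k * xi)%g (r l') * Num.conj (T1 g i (k * xi)%g)}.
  apply: filter_forall => l'; exact: h.
move: h; apply: filterS => xi E.
apply: complexI; rewrite [LHS]rmorphM [RHS]rmorphM !rmorph_sum/= rmorphXn/= !rmorph_nat.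
under [in RHS]eq_bigr do rewrite -normC_sqr.
rewrite -(kernel_plancherel s_uniq sP r_surj r_inj xi (fun k => T1 g i (k * xi)%g)).
rewrite mulr_sumr; apply: eq_bigr => l' _.
by rewrite -E normrM normr_nat exprMn normC_sqr.
Qed.

(** The bracket of e' with itself is computed twice: in the model of W it is the j-th coordinate of
    the generator, and through g it is the fibre sum of [fiber_sqnorm T1 g]. *)
Lemma indicator_transfer e' g j :
  (forall j', {ae mu2, forall x, T2 e' j' x = if j' == j then (\1_(sigma2 j) x)%:C else 0}) ->
  U g = e' ->
  {ae lambda, forall xi, ((size s)%:R%:E * (\1_(sigma2 j) (astar xi))%:E =
    \sum_(k <- s) fiber_sqnorm T1 g (k * xi)%g)%E}.
Proof.
move=> e'E gE.
have Gi : cintegrable lambda (fun x => (fine (fiber_sqnorm T1 g x))%:C).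
  by split; [exact: (integrable_fine_sqnorm SD1 mu1_lambda)|exact: integrable_constant].
have Fi := spectral_cintegrable SD2 mu2_lambda e' j.
have h1 : {ae lambda, forall xi, (size s)%:R * T2 e' j (astar xi) =
    \sum_(k <- s) (fine (fiber_sqnorm T1 g (k * xi)%g))%:C}.
  apply: (transfer Fi Gi) => b.
  rewrite -(inner_square SD1 mu1_lambda).
  rewrite -(inner_generator SD2 mu2_lambda _ _ e'E).
  by rewrite -gE U_rho U_inner.
have h2 := ae_kernel_translates Gamma_countable lambda_haar s (fiber_sqnorm_fin SD1 mu1_lambda g).
have h3 : {ae lambda, forall x, T2 e' j x = (\1_(sigma2 j) x)%:C}.
  by apply: (generator_diag SD2 mu2_lambda); have := e'E j; apply: filterS => x; rewrite eqxx.
have {}h3 := ae_dual_endo Gamma_countable alpha_inj alpha_index lambda_haar h3.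
move: h1 h2 h3; apply: filterS3 => xi e1 e2 e3.
under eq_big_seq => k ks do rewrite -(fineK (e2 k ks)).
rewrite sumEFin -EFinM; congr EFin.
move: e1; rewrite e3 -rmorph_sum -(rmorph_nat (real_complex R)) -rmorphM.
exact: complexI.
Qed.

Lemma multiplicity_fiber chi xi : astar xi = chi ->
  (\esum_(x in [set x | astar x = chi]) multiplicity sigma1 x =
   \sum_(k <- s) multiplicity sigma1 (k * xi)%g)%E.
Proof.
move=> xiE.
have m0 x : (0 <= multiplicity sigma1 x)%E by apply: nneseries_ge0 => i _ _; rewrite lee_fin.
have -> : [set x | astar x = chi] = (fun k : D => (k * xi)%g) @` [set` s].
  apply/seteqP; split => x /=.
    by rewrite -xiE => /(dual_endo_fiber sP)[k ks ->]; exists k.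
  by move=> [k /= ks <-]; rewrite (dual_endo_kernel sP).
rewrite esum_image; last first.
  by move=> x y _ _ /(congr1 (fun z => z * xi^-1)%g); rewrite -!mulgA mulgV !mulg1.
rewrite esum_fset; [|exact: finite_seq|by move=> k _; exact: m0].
by rewrite -fsbig_seq.
Qed.

Lemma multiplicity_upstairs : {ae lambda, forall xi,
  multiplicity sigma2 (astar xi) = (\sum_(k <- s) multiplicity sigma1 (k * xi)%g)%E}.
Proof.
have /choice[e eE] := exists_generator SD1.
have /choice[e' e'E] := exists_generator SD2.
have /choice[g gE] : forall j, exists g, U g = e' j by move=> j; exact: U_surj.
have h1 : {ae lambda, forall xi i l,
    ((size s)%:R%:E * fiber_sqnorm T2 (U (rho1 (r l) (e i))) (astar xi) =
    (\sum_(k <- s) \1_(sigma1 i) (k * xi)%g)%:E)%E}.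
  apply: ae_foralln => i; apply: filter_forall => l; exact: generator_sqnorm_transfer.
have h2 : {ae lambda, forall xi i j, (size s)%:R ^+ 2 *
      \sum_l Normc.normc (T2 (U (rho1 (r l) (e i))) j (astar xi)) ^+ 2 =
    N%:R * \sum_(k <- s) Normc.normc (T1 (g j) i (k * xi)%g) ^+ 2}.
  (* Countably many indices, so a single null set serves for all of them. *)
  by do 2 apply: ae_foralln => ?; exact: coefficient_transfer.
have h3 : {ae lambda, forall xi j, ((size s)%:R%:E * (\1_(sigma2 j) (astar xi))%:E =
    \sum_(k <- s) fiber_sqnorm T1 (g j) (k * xi)%g)%E}.
  by apply: ae_foralln => j; exact: indicator_transfer.
move: h1 h2 h3; apply: filterS3 => xi h1 h2 h3.
pose M : R := (size s)%:R.
have M0 : 0 < M by rewrite ltr0n (size_kernel_gt0 sP).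
have N0 : 0 < N%:R :> R by rewrite ltr0n.
pose A i j := \sum_(k <- s) Normc.normc (T1 (g j) i (k * xi)%g) ^+ 2.
have A0 i j : 0 <= A i j by apply: sumr_ge0 => k _; exact: sqr_ge0.
have cancel (c : R) (a b : \bar R) : 0 < c -> (c%:E * a = c%:E * b)%E -> a = b.
  move=> c0 /(congr1 (fun z => (c^-1)%:E * z)%E).
  by rewrite !muleA -EFinM mulVf ?gt_eqF// !mul1e.
(* N times the row sum is M^2 times a sum over l of values of [fiber_sqnorm T2]. By [h1], M times
   each value is the same indicator sum, so the N terms give M N times it, and N cancels. *)
have rows i : (\sum_(j <oo) (A i j)%:E = M%:E * (\sum_(k <- s) \1_(sigma1 i) (k * xi)%g)%:E)%E.
  apply: (cancel _ _ _ N0); rewrite -nneseriesZl; last by move=> j _; rewrite lee_fin.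
  transitivity (\sum_(j <oo) \sum_(l < N) (M ^+ 2)%:E *
      (Normc.normc (T2 (U (rho1 (r l) (e i))) j (astar xi)) ^+ 2)%:E)%E.
    apply: eq_eseriesr => j _; rewrite -EFinM -h2 mulr_sumr -sumEFin.
    by apply: eq_bigr => l _.
  rewrite nneseries_sum; last by move=> l j _; rewrite -EFinM lee_fin mulr_ge0// sqr_ge0.
  under eq_bigr => l _.
    rewrite nneseriesZl; last by move=> j _; rewrite lee_fin sqr_ge0.
    rewrite -/(fiber_sqnorm T2 _ _) expr2 EFinM -muleA h1 -EFinM.
    over.
  rewrite sumEFin sumr_const card_ord -!EFinM.
  by congr EFin; exact: esym (mulr_natl _ _).
have cols j : (\sum_(i <oo) (A i j)%:E = M%:E * (\1_(sigma2 j) (astar xi))%:E)%E.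
  rewrite h3 -nneseries_sum; last by move=> k i _; rewrite lee_fin sqr_ge0.
  by apply: eq_eseriesr => i _; rewrite sumEFin.
apply: (cancel _ _ _ M0).
rewrite /multiplicity -nneseriesZl; last by move=> j _; rewrite lee_fin.
under eq_eseriesr do rewrite -cols.
(* Tonelli for the nonnegative array [A] turns column sums, which count the multiplicity of W, into
   row sums, which count that of V along the fibre. *)
rewrite nneseries_interchange; last by move=> *; rewrite lee_fin.
under eq_eseriesr do rewrite rows.
rewrite nneseriesZl; last by move=> i _; rewrite lee_fin sumr_ge0.
rewrite -nneseries_sum; last by move=> *; rewrite lee_fin.
by under [in RHS]eq_eseriesr do rewrite sumEFin.
Qed.

End Fibers.

Lemma multiplicity_transfer : {ae lambda, forall chi,
  multiplicity sigma2 chi =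
    (\esum_(xi in [set xi | astar xi = chi]) multiplicity sigma1 xi)%E}.
Proof.
have [s [s_uniq sP]] := kernel_enum R alpha_index.
have [r [r_surj r_inj]] := coset_representatives alpha_index.
apply: (ae_descends Gamma_countable alpha_inj alpha_index lambda_haar s_uniq sP).
apply: filterS (multiplicity_upstairs s_uniq sP r_surj r_inj) => xi ->.
by rewrite (multiplicity_fiber s_uniq sP (erefl (astar xi))).
Qed.

End MultiplicityTransfer.

(** * Restriction of the unitary to V and conclusion *)

Lemma ae_restriction (R : realType) (Gamma : zmodType)
    (lambda : probability (dual_group R Gamma) R)
    (mu : {finite_measure set (dual_group R Gamma) -> \bar R})
    (S : set (dual_group R Gamma)) (P : dual_group R Gamma -> Prop) :
  measurable S ->
  (forall E, measurable E -> mu E = lambda (E `&` S)) ->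
  {ae lambda, forall x, P x} -> {ae mu, forall x, P x}.
Proof.
move=> mS muE [Z [mZ Z0 PZ]]; exists Z; split => //.
rewrite muE//; apply/eqP; rewrite -measure_le0 -Z0 le_measure ?inE//.
exact: measurableI.
Qed.

Lemma countable_subgroup (G : zmodType) (Gamma : zmodClosed G) :
  countable [set` Gamma] -> countable [set: subgroup_of Gamma].
Proof.
move=> /countable_injP[f finj]; apply/countable_injP; exists (f \o @subgroup_val G Gamma).
move=> x y _ _ /= e; apply: val_inj; apply: finj => //; rewrite inE/=; exact: subgroup_valP.
Qed.

Section UnitaryImage.
Variables (R : realType) (H : hilbertType R) (delta : unitary H H) (V : closed_subspace H).

Fact unitary_image_subproof (x : subspace_type V) :
  delta (subspace_val x) \in in_subspace (unitary_image delta V).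
Proof.
apply/mem_set; exists (subspace_val x) => //.
exact: set_mem (subspace_valP x).
Qed.

Definition unitary_corestriction (x : subspace_type V) :
    subspace_type (unitary_image delta V) :=
  SubspaceType (unitary_image_subproof x).

Lemma unitary_corestriction_surj y : exists x, unitary_corestriction x = y.
Proof.
have [x Vx xy] := set_mem (subspace_valP y).
by exists (SubspaceType (mem_set Vx : x \in in_subspace V)); apply: val_inj.
Qed.

End UnitaryImage.

Theorem lemma5p5 (R : realType)
  (G : topologicalZmodType)
  (G_hausdorff : hausdorff_space G)
  (G_second_countable : @second_countable G)
  (G_locally_compact : locally_compact [set: G])
  (Gamma : zmodClosed G)
  (Gamma_closed : closed [set` Gamma])
  (Gamma_countable : countable [set` Gamma])
  (Gamma_discrete : [set` Gamma] `<=` isolated [set` Gamma])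
  (lambda : probability (dual_group R (subgroup_of Gamma)) R)
  (lambda_haar : normalized_haar lambda)
  (alpha : {additive subgroup_of Gamma -> subgroup_of Gamma})
  (alpha_inj : injective alpha)
  (N : nat) (N_gt1 : (1 < N)%N)
  (alpha_index : (cosets alpha #= `I_N)%card)
  (alpha_ergodic : ergodic lambda (@dual_endo R _ alpha))
  (H : hilbertType R) (H_separable : separable H)
  (pi : unitary_rep (subgroup_of Gamma) H)
  (pi_ac : spectral_measure_ac pi lambda)
  (delta : unitary H H)
  (delta_pi : forall gamma f,
    unitary_inv delta (pi gamma (delta f)) = pi (alpha gamma) f)
  (V : closed_subspace H) (V_invariant : rep_invariant pi V)
  (mu_V : {finite_measure set (dual_group R (subgroup_of Gamma)) -> \bar R})
  (m_V : dual_group R (subgroup_of Gamma) -> \bar R)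
  (mu_m_V : spectral_measure_mult (subrep V_invariant) lambda mu_V m_V)
  (mu_W : {finite_measure set (dual_group R (subgroup_of Gamma)) -> \bar R})
  (m_W : dual_group R (subgroup_of Gamma) -> \bar R)
  (mu_m_W : spectral_measure_mult
    (subrep (invariant_unitary_image delta_pi V_invariant)) lambda mu_W m_W) :
  {ae mu_W, forall chi,
    m_W chi = (\esum_(xi in [set xi | dual_endo alpha xi = chi]) m_V xi)%E}.
Proof.
have Gct := countable_subgroup Gamma_countable.
have [sigma1 [T1 [SD1 mu1E m1E]]] := mu_m_V.
have [sigma2 [T2 [SD2 mu2E m2E]]] := mu_m_W.
have ms : measurable (sigma2 0%N) by case: SD2 => -[].
(* [mu_W] is the restriction of [lambda] to [sigma2 0], so an identity valid [lambda]-almost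
   everywhere is enough. *)
apply: (ae_restriction ms mu2E).
have U_rho a (x : subspace_type V) :
    subrep (invariant_unitary_image delta_pi V_invariant) a (unitary_corestriction delta x) =
    unitary_corestriction delta (subrep V_invariant (alpha a) x).
  by apply: val_inj; rewrite /= -delta_pi unitary_invK.
have U_inner (x y : subspace_type V) :
    '[unitary_corestriction delta x, unitary_corestriction delta y] = '[x, y] :> R[i].
  exact: (unitary_inner delta).
have := multiplicity_transfer Gct alpha_inj (ltnW N_gt1) alpha_index lambda_haar
  U_inner (@unitary_corestriction_surj _ _ delta V) U_rho SD1 mu1E SD2 mu2E.
by apply: filterS => chi; rewrite m2E => ->; apply: eq_esum => xi _; rewrite m1E.
Qed.
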